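(* Let $K$ be a field. The following assertions are equivalent: (1) For any integer $n\ge1$ and any monomial ideal $I\subset S=K[x_1,\ldots,x_n]$, one has $\operatorname{sdepth}_S(I)\ge\operatorname{depth}_S(I)$. (2) For any integer $n\ge1$ and any monomial ideals $I,J\subset S=K[x_1,\ldots,x_n]$: if $\operatorname{sdepth}_S(I\cap J)\ge\operatorname{depth}_S(I\cap J)$, then $\operatorname{sdepth}_S(I)\ge\operatorname{depth}_S(I)$. (3) For any integers $n,m\ge1$ and any monomial ideal $I\subset S=K[x_1,\ldots,x_n]$, if $u_1,\ldots,u_m\in S$ are monomials forming a regular sequence on $S/I$ and $J=(u_1,\ldots,u_m)$, then $$\operatorname{sdepth}_S(I\cap J)\ge\operatorname{depth}_S(I\cap J)\ \Rightarrow\ \operatorname{sdepth}_S(I)\ge\operatorname{depth}_S(I).$$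
   Context: Let $S=K[x_1,\ldots,x_n]$ with its $\mathbb Z^n$-grading, and let $M\neq 0$ be a finitely generated $\mathbb Z^n$-graded $S$-module. A Stanley decomposition of $M$ is a finite direct sum decomposition of $K$-vector spaces $\mathcal D: M=\bigoplus_{i=1}^t m_iK[Z_i]$, where the $m_i\in M$ are homogeneous, $Z_i\subset\{x_1,\ldots,x_n\}$, and each $m_iK[Z_i]$ is a free $K[Z_i]$-module. Put $\operatorname{sdepth}(\mathcal D)=\min_i|Z_i|$, and let $\operatorname{sdepth}_S(M)$ be the maximum of $\operatorname{sdepth}(\mathcal D)$ over all Stanley decompositions of $M$. The depth $\operatorname{depth}_S(M)$ is taken with respect to the ideal $(x_1,\ldots,x_n)$. Both invariants are considered only for nonzero modules; monomial ideals in the assertions are nonzero and proper. *)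

(* Defs.v *)
From HB Require Import structures.
From mathcomp Require Import all_boot all_order all_algebra.
From mathcomp Require Import boolp classical_sets.
From mathcomp Require Import mpoly.

Set Implicit Arguments.
Unset Strict Implicit.
Unset Printing Implicit Defensive.

Import GRing.Theory.
Local Open Scope classical_set_scope.
Local Open Scope ring_scope.

(* The junk value 0 is used only when A has no maximum. *)
Definition nat_max (A : set nat) : nat :=
  xget 0%N [set d | A d /\ forall e, A e -> (e <= d)%N].

Section Regular.
Variable R : comNzRingType.
Implicit Types (I M N A : set R) (us : seq R).

Definition is_ideal I : Prop :=
  [/\ I 0, forall p q, I p -> I q -> I (p + q) & forall a p, I p -> I (a * p)].

Definition ideal_gen A : set R := smallest is_ideal A.

(* N + (us)M, so that M / (adjoin_mul M N us) is (M/N) / (us)(M/N). *)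
Definition adjoin_mul M N us : set R :=
  ideal_gen (N `|` [set u * x | u in [set` us] & x in M]).

(* us is a regular sequence on the R-module M/N, for ideals N `<=` M of R. *)
Definition regular_seq M N us : Prop :=
  (forall i, (i < size us)%N -> forall x, M x ->
     adjoin_mul M N (take i us) (us`_i * x) -> adjoin_mul M N (take i us) x)
  /\ adjoin_mul M N us <> M.

End Regular.

Section StanleyDepth.
Variables (K : fieldType) (n : nat).
Local Notation S := {mpoly K[n]}.
Implicit Types (I : set S) (u : S) (Z : {set 'I_n}).

Definition is_monomial u : Prop := exists a : 'X_{1..n}, u = 'X_[a].

Definition is_monomial_ideal I : Prop :=
  exists2 A : set S, (forall u, A u -> is_monomial u) & I = ideal_gen A.

Definition nonzero_proper I : Prop := I <> [set 0] /\ I <> [set: S].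

Definition irrelevant_ideal : set S := ideal_gen (range (fun i : 'I_n => 'X_i)).

(* Depth of I as an S-module, with respect to (x_1, ..., x_n). *)
Definition depth I : nat :=
  nat_max [set d | exists us : d.-tuple S,
    (forall u, u \in us -> irrelevant_ideal u) /\ regular_seq I [set 0] us].

(* The component of S of degree a in Z^n is K x^a if a >= 0, and 0 otherwise. *)
Definition is_Zn_homogeneous u : Prop :=
  exists (c : K) (a : 'X_{1..n}), u = c *: 'X_[a].

(* The subring K[Z] of S. *)
Definition subpoly Z : set S :=
  [set f | forall a, a \in msupp f -> forall j, a j != 0%N -> j \in Z].

Definition stanley_space u Z : set S := [set u * f | f in subpoly Z].

Definition stanley_decomposition I (t : nat)
    (m : 'I_t -> S) (Z : 'I_t -> {set 'I_n}) : Prop :=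
  [/\ forall i, I (m i) /\ is_Zn_homogeneous (m i),
      (* m_i K[Z_i] is free over K[Z_i], with basis m_i *)
      forall i f, subpoly (Z i) f -> m i * f = 0 -> f = 0,
      I = [set \sum_(i < t) w i |
             w in [set w : 'I_t -> S | forall i, stanley_space (m i) (Z i) (w i)]]
    & forall w : 'I_t -> S, (forall i, stanley_space (m i) (Z i) (w i)) ->
        \sum_(i < t) w i = 0 -> forall i, w i = 0].

(* The default value n is harmless, since #|Z i| <= n and t > 0 when I != 0. *)
Definition sdepth_decomposition (t : nat) (Z : 'I_t -> {set 'I_n}) : nat :=
  \big[minn/n]_(i < t) #|Z i|.

Definition sdepth I : nat :=
  nat_max [set d | exists (t : nat) (m : 'I_t -> S) (Z : 'I_t -> {set 'I_n}),
    stanley_decomposition I m Z /\ sdepth_decomposition Z = d].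

End StanleyDepth.

(* Main.v *)
Require Import Defs.
From mathcomp Require Import all_boot all_order all_algebra.

(** The implications (1) => (2) => (3) are formal: the second only needs that
    monomials forming a regular sequence on a nonzero ring generate a nonzero
    proper ideal.  The content is (3) => (1).

    Let I be a nonzero proper monomial ideal of S = K[x_1..x_n], let I' be its
    extension to S' = K[x_1..x_n, y_1..y_m], and take u_j = y_j, so that
    J = (y_1..y_m).  The y_j form a regular sequence on S'/I'.  Adjoining
    variables raises depth by at least m ([depth_ext_ge]) and Stanley depth by
    at most m ([sdepth_ext_le]), so the conclusion of (3) for I' gives
      depth I + m <= depth I' <= sdepth I' <= sdepth I + m,
    which is (1) for I (when depth I = 0 there is nothing to prove).  It remains to
    choose m so that the hypothesis depth (I' /\ J) <= sdepth (I' /\ J) of (3) holds.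
    The left side is at most n + 1 whatever m is, while the right side is unbounded as
    m grows: this is [depth_meets_le_sdepth], with m = 3 ^ n.

    Upper bounds on depth come from Koszul cohomology.  A regular sequence of
    length r on an ideal M, whose terms lie in (x), forces H^p(x; M) = 0 for all
    p < r ([koszul_exact_regular]).  So it is enough to exhibit one nonzero class.
    Let u be a monomial of least degree in I'.  For M = I' itself the class of
    u dx_1 ... dx_n dy_1 ... dy_m shows that regular sequences have length at most
    n + m; for M = I' /\ J the coboundary in S' of u dx_1 ... dx_n has values in M
    and is not a coboundary in M, which gives the bound n + 1
    ([regular_seq_meets_size_le]).

    Stanley decompositions of a monomial ideal are partitions of its set of
    exponents into finitely many boxes ([sdepth_ge], [sdepth_boxes]).  For the lower
    bound on sdepth (I' /\ J), exponents in x are sorted by their truncation at a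
    large constant, and exponents in y by their support.  The nonempty subsets of a
    set of 3 ^ k elements can be partitioned into intervals whose tops have at least
    k + 1 elements ([top_heavy_exp3]), so every box has at least n + 1 free
    directions when k = n. *)

Set Implicit Arguments.
Unset Strict Implicit.
Unset Printing Implicit Defensive.

(** * Interval partitions of Boolean lattices *)

Section Intervals.
Variable T : finType.
Implicit Types (A B X Y Z : {set T}) (F H : pred {set T}) (k l : nat).

(** The intervals are given by the functions sending a member of F to the bottom
    and to the top of its interval.  That these functions are constant on every
    interval says at once that the intervals are disjoint and that they stay
    inside F; no list of intervals has to be kept. *)
Definition interval_partition X k F := exists L U : {set T} -> {set T},
  forall A, F A -> [/\ L A \subset A, A \subset U A, U A \subset X, k <= #|U A|
    & forall B, L A \subset B -> B \subset U A -> [/\ F B, L B = L A & U B = U A]].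

Lemma eq_interval_partition X k F H :
  F =1 H -> interval_partition X k F -> interval_partition X k H.
Proof.
move=> FH [L [U LU]]; exists L, U => A; rewrite -FH => /LU[LA AU UX kU int].
by split=> // B LB BU; rewrite -FH; apply: int.
Qed.

Lemma interval_partition_single A B X : A \subset B -> B \subset X ->
  interval_partition X #|B| (fun C => (A \subset C) && (C \subset B)).
Proof.
move=> AB BX; exists (fun=> A), (fun=> B) => C /andP[AC CB].
by split=> // D AD DB; rewrite AD DB.
Qed.

Lemma interval_partitionU X k F H : (forall A, F A -> ~~ H A) ->
  interval_partition X k F -> interval_partition X k H ->
  interval_partition X k (predU F H).
Proof.
move=> FH [L [U LU]] [L' [U' LU']].
exists (fun A => if F A then L A else L' A), (fun A => if F A then U A else U' A).
move=> A /=; have [/LU[LA AU UX kU int] _|_ /LU'[LA AU UX kU int]] := ifP; split=> //.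
  by move=> B LB BU; have [FB -> ->] := int B LB BU; rewrite /= FB.
move=> B LB BU; have [HB -> ->] := int B LB BU.
by have [/FH|_] := boolP (F B); rewrite /= ?HB // orbT.
Qed.

Definition prod_family X Y F H : pred {set T} :=
  fun A => [&& A \subset X :|: Y, F (A :&: X) & H (A :&: Y)].

(** Products of intervals are intervals when the ground sets are disjoint, and the
    sizes of the tops add up. *)
Lemma interval_partition_prod X Y k l F H : [disjoint X & Y] ->
  interval_partition X k F -> interval_partition Y l H ->
  interval_partition (X :|: Y) (k + l) (prod_family X Y F H).
Proof.
move=> XY [L [U LU]] [L' [U' LU']].
have cutX A B : A \subset X -> B \subset Y -> (A :|: B) :&: X = A.
  move=> AX BY; rewrite setIUl (setIidPl AX) (disjoint_setI0 _) ?setU0 //.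
  by rewrite disjoint_sym (disjointWr BY).
have cutY A B : A \subset X -> B \subset Y -> (A :|: B) :&: Y = B.
  move=> AX BY; rewrite setIUl (setIidPl BY) (disjoint_setI0 _) ?set0U //.
  by rewrite (disjointWl AX).
exists (fun A => L (A :&: X) :|: L' (A :&: Y)), (fun A => U (A :&: X) :|: U' (A :&: Y)).
move=> A /and3P[AXY /LU[LA AU UX kU int] /LU'[LA' AU' UY lU' int']].
have LX := subset_trans LA (subsetIr _ _).
have LY := subset_trans LA' (subsetIr _ _).
have splitA : A = (A :&: X) :|: (A :&: Y) by rewrite -setIUr (setIidPl AXY).
split.
- by apply: subset_trans (setUSS LA LA') _; rewrite -splitA.
- by apply: subset_trans _ (setUSS AU AU'); rewrite -splitA.
- exact: setUSS.
- have UXY : [disjoint U (A :&: X) & U' (A :&: Y)].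
    by rewrite (disjointWl UX) // (disjointWr UY).
  by rewrite cardsU (disjoint_setI0 UXY) cards0 subn0 leq_add.
- move=> B LB BU.
  have [||FB -> ->] := int (B :&: X).
  + by rewrite -(cutX _ _ LX LY) setSI.
  + by rewrite -(cutX _ _ UX UY) setSI.
  have [||HB -> ->] := int' (B :&: Y).
  + by rewrite -(cutY _ _ LX LY) setSI.
  + by rewrite -(cutY _ _ UX UY) setSI.
  split=> //; rewrite /prod_family FB HB (subset_trans BU) //.
  exact: setUSS.
Qed.

Definition nonempty_subsets X : pred {set T} :=
  fun A => (A \subset X) && (A != set0).

(** Combinatorially, top_heavy X k says that the maximal ideal of a polynomial ring
    with X as its set of variables has a squarefree Stanley decomposition of Stanley
    depth at least k. *)
Definition top_heavy X k := interval_partition X k (nonempty_subsets X).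

Lemma interval_partition_le X k l F :
  l <= k -> interval_partition X k F -> interval_partition X l F.
Proof.
move=> lk [L [U LU]]; exists L, U => A /LU[LA AU UX kU int].
by split=> //; apply: leq_trans kU.
Qed.

(** For k = 1 and singletons this is the partition of the nonempty subsets of
    {X, Y, Z} into [X, XY], [Y, YZ], [Z, ZX] and [XYZ, XYZ].  In general a set is
    sorted by which of the three blocks it meets.  In each of the first three
    classes the second block is left free, so the top of an interval of the first
    block gains at least one element; in the last class the tops of three intervals
    are united. *)
Lemma top_heavyU3 X Y Z k : 0 < k ->
  [disjoint X & Y] -> [disjoint X & Z] -> [disjoint Y & Z] ->
  X != set0 -> Y != set0 -> Z != set0 ->
  top_heavy X k -> top_heavy Y k -> top_heavy Z k -> top_heavy (X :|: Y :|: Z) k.+1.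
Proof.
have two (A B C : {set T}) : [disjoint A & B] -> [disjoint A & C] -> [disjoint B & C] ->
    B != set0 -> top_heavy A k -> interval_partition (A :|: B :|: C) k.+1
      (fun D => [&& D \subset A :|: B :|: C, D :&: A != set0 & D :&: C == set0]).
  move=> AB AC BC; rewrite -card_gt0 => B0 gA.
  (* Arbitrary subsets of B form a single interval, and D does not meet C. *)
  have gB := interval_partition_single (sub0set B) (subxx B).
  have gC := interval_partition_single (subxx (@set0 T)) (sub0set C).
  have ABC : [disjoint A :|: B & C].
    by rewrite -setI_eq0 setIUl !disjoint_setI0 ?setU0.
  have := interval_partition_prod ABC (interval_partition_prod AB gA gB) gC.
  rewrite cards0 addn0; move/(@interval_partition_le _ _ k.+1).
  rewrite -addn1 leq_add2l => /(_ B0); apply: eq_interval_partition => D.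
  rewrite /prod_family /nonempty_subsets !sub0set !subsetIr subset0 /=.
  by rewrite -setIA (setIidPr (subsetUl A B)) andbT.
move=> k0 XY XZ YZ X0 Y0 Z0 gX gY gZ.
have [YX ZX ZY] : [/\ [disjoint Y & X], [disjoint Z & X] & [disjoint Z & Y]].
  by split; rewrite disjoint_sym.
have XYZ : [disjoint X :|: Y & Z] by rewrite -setI_eq0 setIUl !disjoint_setI0 ?setU0.
have p1 := two X Y Z XY XZ YZ Y0 gX.
have := two Y Z X YZ YX ZX Z0 gY; rewrite setUC setUA => p2.
have := two Z X Y ZX ZY XY X0 gZ; rewrite -setUA setUC => p3.
have k3 : k.+1 <= k + k + k by rewrite -addnA -addn1 leq_add2l addn_gt0 k0.
have p4 : interval_partition (X :|: Y :|: Z) k.+1 (fun D => [&& D \subset X :|: Y :|: Z,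
    D :&: X != set0, D :&: Y != set0 & D :&: Z != set0]).
  apply: eq_interval_partition (interval_partition_le k3
    (interval_partition_prod XYZ (interval_partition_prod XY gX gY) gZ)) => D.
  rewrite /prod_family /nonempty_subsets !subsetIr /=.
  by rewrite -!setIA (setIidPr (subsetUl X Y)) (setIidPr (subsetUr X Y)) -andbA.
apply: eq_interval_partition
  (interval_partitionU _ p1 (interval_partitionU _ p2 (interval_partitionU _ p3 p4))).
- move=> D; rewrite /nonempty_subsets /=.
  have [DXYZ|//] := boolP (D \subset _).
  have -> : (D == set0) = [&& D :&: X == set0, D :&: Y == set0 & D :&: Z == set0].
    by rewrite -{1}(setIidPl DXYZ) !setIUr !setU_eq0 andbA.
  by do 3!case: (_ == set0).
- by move=> D /and3P[_ DX DZ]; rewrite /= DZ (negPf DX) !(andbF, andbT).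
- by move=> D /and3P[_ DY DX]; rewrite /= DX (negPf DY) !(andbF, andbT).
- by move=> D /and3P[_ DZ DY]; rewrite /= DY !(andbF, andbT).
Qed.

Lemma exists_subset_card X k : k <= #|X| -> exists2 Y : {set T}, Y \subset X & #|Y| = k.
Proof.
move=> kX; exists [set x in take k (enum X)].
  by apply/subsetP => x; rewrite inE => /mem_take; rewrite mem_enum.
rewrite cardsE (card_uniqP _) ?take_uniq ?enum_uniq // size_takel //.
by rewrite -cardE.
Qed.

(** Each tripling of the ground set raises the size of the tops by one; the exact
    optimum, about half the size of X, is far larger, but any unbounded function
    suffices here. *)
Lemma top_heavy_exp3 k X : #|X| = 3 ^ k -> top_heavy X k.+1.
Proof.
elim: k X => [|k IHk] X.
  move=> /eqP/cards1P[x ->]; rewrite /top_heavy -(cards1 x).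
  apply: eq_interval_partition
    (interval_partition_single (subxx [set x]) (subxx [set x])).
  move=> A; rewrite /nonempty_subsets subset1 andbC.
  have [->|_] := eqVneq A [set x]; first by rewrite subxx -card_gt0 cards1.
  by have [->|_] := eqVneq A set0; rewrite ?sub1set ?in_set0.
move=> cX; have [|Y YX cY] := @exists_subset_card X (3 ^ k).
  by rewrite cX leq_exp2l.
have cXY : #|X :\: Y| = 3 ^ k + 3 ^ k.
  by rewrite cardsD (setIidPr YX) cX cY expnS mulSn addKn mul2n addnn.
have [|Z ZXY cZ] := @exists_subset_card (X :\: Y) (3 ^ k).
  by rewrite cXY leq_addr.
have cW : #|X :\: Y :\: Z| = 3 ^ k by rewrite cardsD (setIidPr ZXY) cXY cZ addKn.
have pos (W : {set T}) : #|W| = 3 ^ k -> W != set0.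
  by move=> cardW; rewrite -card_gt0 cardW expn_gt0.
have XYZ : X = Y :|: Z :|: (X :\: Y :\: Z).
  rewrite -setUA -{1}(setIidPr ZXY) setID -{1}(setIidPr YX).
  by rewrite setID.
have /subsetDP[/subsetDP[_ WY] WZ] := subxx (X :\: Y :\: Z).
have /subsetDP[_ ZY] := ZXY.
rewrite XYZ; apply: top_heavyU3 => //; try exact: pos; try exact: IHk.
all: by rewrite disjoint_sym.
Qed.

End Intervals.

(* The names of set-theoretic lemmas refer to finite sets above this line and to
   classical sets below it. *)
From mathcomp Require Import boolp classical_sets.
From mathcomp Require Import mpoly.
From mathcomp Require Import ring.

Import GRing.Theory.

(** * Maxima of sets of natural numbers *)

Section NatMax.
Local Open Scope classical_set_scope.
Implicit Types (A : set nat) (b d : nat).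

Lemma nat_max_attained A : (0 < nat_max A)%N -> A (nat_max A).
Proof. by rewrite /nat_max; case: xgetP => // d _ []. Qed.

Lemma nat_max_le A b : (forall d, A d -> (d <= b)%N) -> (nat_max A <= b)%N.
Proof. by rewrite /nat_max; case: xgetP => // d _ [Ad _]; apply. Qed.

Lemma le_nat_max A b d : (forall e, A e -> (e <= b)%N) -> A d ->
  (d <= nat_max A)%N.
Proof.
move=> Ab Ad.
have exA : exists n, `[<A n>] by exists d; apply/asboolP.
have ubA n : `[<A n>] -> (n <= b)%N by move/asboolP/Ab.
case: (ex_maxnP exA ubA) => k /asboolP Ak kmax.
rewrite /nat_max; case: xgetP => [e _ [_]|/(_ k)]; first exact.
by case; split=> // e /asboolP/kmax.
Qed.

End NatMax.

(** * Ideals *)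

Section Ideals.
Local Open Scope classical_set_scope.
Local Open Scope ring_scope.
Variable R : comNzRingType.
Implicit Types (I M N A : set R) (us : seq R) (f x : R).

Lemma ideal_gen_ideal A : is_ideal (ideal_gen A).
Proof.
split=> [B [[]] // | p q Ip Iq B BP | a p Ip B BP].
- by have [[_ BD _] _] := BP; apply: BD; [apply: Ip|apply: Iq].
- by have [[_ _ BM] _] := BP; apply: BM; apply: Ip.
Qed.

Lemma ideal_gen_gen A : A `<=` ideal_gen A.
Proof. exact: sub_gen_smallest. Qed.

Lemma ideal_gen_min A I : is_ideal I -> A `<=` I -> ideal_gen A `<=` I.
Proof. exact: smallest_sub. Qed.

Section Closure.
Variables (I : set R) (idI : is_ideal I).

Lemma ideal0 : I 0. Proof. by case: idI. Qed.
Lemma idealD p q : I p -> I q -> I (p + q). Proof. by case: idI => _ + _; apply. Qed.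
Lemma idealM a p : I p -> I (a * p). Proof. by case: idI => _ _; apply. Qed.
Lemma idealMr a p : I p -> I (p * a). Proof. by rewrite mulrC; apply: idealM. Qed.
Lemma idealN p : I p -> I (- p). Proof. by rewrite -mulN1r; apply: idealM. Qed.
Lemma idealB p q : I p -> I q -> I (p - q).
Proof. by move=> Ip Iq; apply: idealD => //; apply: idealN. Qed.
Lemma ideal_sum (T : Type) (r : seq T) (P : pred T) (F : T -> R) :
  (forall i, P i -> I (F i)) -> I (\sum_(i <- r | P i) F i).
Proof. by move=> IF; elim/big_ind: _ => //; [apply: ideal0|apply: idealD]. Qed.

End Closure.

Lemma set0_ideal : is_ideal [set (0 : R)].
Proof.
by split=> [|p q -> ->|a p ->] //=; rewrite ?addr0 ?mulr0.
Qed.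

Lemma adjoin_mul_ideal M N us : is_ideal (adjoin_mul M N us).
Proof. exact: ideal_gen_ideal. Qed.

Lemma adjoin_mul_base M N us : N `<=` adjoin_mul M N us.
Proof. by move=> x Nx; apply: ideal_gen_gen; left. Qed.

Lemma adjoin_mul_mul M N us u x : u \in us -> M x -> adjoin_mul M N us (u * x).
Proof. by move=> uus Mx; apply: ideal_gen_gen; right; exists u => //; exists x. Qed.

Lemma adjoin_mul_min M N us I : is_ideal I -> N `<=` I ->
  (forall u x, u \in us -> M x -> I (u * x)) -> adjoin_mul M N us `<=` I.
Proof.
move=> idI NI usI; apply: ideal_gen_min => // _ [/NI //|[u uus [x Mx <-]]].
exact: usI.
Qed.

(** This splitting off of the last term, N + (us, f)M = (N + (us)M) + fM, is what makes
    induction along a regular sequence possible. *)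
Lemma adjoin_mul_rcons M N us f x : is_ideal M ->
  adjoin_mul M N (rcons us f) x ->
  exists2 y, adjoin_mul M N us y & exists2 z, M z & x = y + f * z.
Proof.
move=> idM; set B := adjoin_mul M N us.
have idB : is_ideal B by exact: adjoin_mul_ideal.
pose C : set R := [set x | exists2 y, B y & exists2 z, M z & x = y + f * z].
suff: adjoin_mul M N (rcons us f) `<=` C by exact.
apply: adjoin_mul_min.
- split.
  + by exists 0; [exact: (ideal0 idB)|exists 0];
      [exact: (ideal0 idM)|rewrite mulr0 addr0].
  + move=> _ _ [y By [z Mz ->]] [y' By' [z' Mz' ->]].
    exists (y + y'); first exact: (idealD idB).
    by exists (z + z'); [exact: (idealD idM)|ring].
  + move=> a _ [y By [z Mz ->]]; exists (a * y); first exact: (idealM idB).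
    by exists (a * z); [exact: (idealM idM)|ring].
- move=> y Ny; exists y; first exact: adjoin_mul_base.
  by exists 0; [exact: (ideal0 idM)|rewrite mulr0 addr0].
- move=> u z; rewrite mem_rcons inE => /orP[/eqP->|uus] Mz.
    by exists 0; [exact: (ideal0 idB)|exists z; rewrite ?add0r].
  exists (u * z); first exact: adjoin_mul_mul.
  by exists 0; [exact: (ideal0 idM)|rewrite mulr0 addr0].
Qed.

End Ideals.

(** * Koszul cochains *)

Section Koszul.
Local Open Scope classical_set_scope.
Local Open Scope ring_scope.
Variables (R : comNzRingType) (T : finType).
Implicit Types (c d g : T -> R) (w v : seq T -> R) (s r : seq T).

(** Koszul cochains of degree p are represented by arbitrary functions on sequences
    of p indices, with no alternation required.  Then wedge c is exterior
    multiplication by the 1-form sum_j c_j dx_j, in closed form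
      (wedge c w) (j_0 ... j_p) = sum_i (-1)^i c_(j_i) w (j_0 .. ^j_i .. j_p),
    and the recursion on the sequence makes all the signs implicit.  The degree is
    not recorded: the value at a sequence of length p.+1 only depends on the values
    at sequences of length p ([eq_wedge]). *)
Fixpoint wedge c w s : R :=
  if s is j :: s' then c j * w s' - wedge c (fun r => w (j :: r)) s' else 0.

(** Contraction with the vector field g. *)
Definition contract g w s : R := \sum_j g j * w (j :: s).

Lemma eq_wedge c w v s :
  (forall r, (size r).+1 = size s -> w r = v r) -> wedge c w s = wedge c v s.
Proof.
elim: s w v => //= j s IHs w v wv; congr (_ * _ - _); first exact: wv.
by apply: IHs => r sr; apply: wv; rewrite /= sr.
Qed.

Lemma wedge_ideal (I : set R) c w s : is_ideal I ->
  (forall j r, (size r).+1 = size s -> I (c j * w r)) -> I (wedge c w s).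
Proof.
move=> idI; elim: s w => [|j s IHs] w Iw /=; first exact: ideal0.
apply: idealB => //; first exact: Iw.
by apply: IHs => i r sr; apply: Iw; rewrite /= sr.
Qed.

Lemma wedgeD c w v s : wedge c (fun r => w r + v r) s = wedge c w s + wedge c v s.
Proof. by elim: s w v => [|j s IHs] w v /=; rewrite ?addr0 // IHs; ring. Qed.

Lemma wedgeZ c a w s : wedge c (fun r => a * w r) s = a * wedge c w s.
Proof. by elim: s w => [|j s IHs] w /=; rewrite ?mulr0 // IHs; ring. Qed.

Lemma wedge0 c s : wedge c (fun=> 0) s = 0.
Proof. by elim: s => //= j s ->; rewrite mulr0 subr0. Qed.

Lemma wedgeB c w v s : wedge c (fun r => w r - v r) s = wedge c w s - wedge c v s.
Proof. by elim: s w v => [|j s IHs] w v /=; rewrite ?subr0 // IHs; ring. Qed.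

Lemma wedge_sumr c (J : Type) (js : seq J) (w : J -> seq T -> R) s :
  wedge c (fun r => \sum_(j <- js) w j r) s = \sum_(j <- js) wedge c (w j) s.
Proof.
elim: js => [|j js IHjs].
  by rewrite big_nil -[RHS](wedge0 c s); apply: eq_wedge => r _; rewrite big_nil.
rewrite big_cons -IHjs -wedgeD; apply: eq_wedge => r _.
by rewrite big_cons.
Qed.

Lemma wedge_suml (J : finType) (c : J -> T -> R) w s :
  wedge (fun i => \sum_j c j i) w s = \sum_j wedge (c j) w s.
Proof.
elim: s w => [|i s IHs] w /=; first by rewrite big1.
by rewrite IHs mulr_suml -sumrB.
Qed.

Lemma wedgeZl a c w s : wedge (fun i => a * c i) w s = a * wedge c w s.
Proof. by elim: s w => [|i s IHs] w /=; rewrite ?mulr0 // IHs; ring. Qed.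

Lemma wedgeDl c d w s : wedge (fun i => c i + d i) w s = wedge c w s + wedge d w s.
Proof. by elim: s w => [|i s IHs] w /=; rewrite ?addr0 // IHs; ring. Qed.

Lemma wedge_anticomm c d w s :
  wedge c (wedge d w) s = - wedge d (wedge c w) s.
Proof.
elim: s w => [|j s IHs] w /=; first by rewrite oppr0.
by rewrite !wedgeB !wedgeZ IHs; ring.
Qed.

Lemma wedge_square c w s : wedge c (wedge c w) s = 0.
Proof.
elim: s w => [|j s IHs] w //=.
by rewrite wedgeB wedgeZ IHs; ring.
Qed.

(** Cartan's homotopy formula: multiplication by sum_j g_j c_j is null-homotopic on
    the Koszul complex of c. *)
Lemma wedge_contract c g w s :
  wedge c (contract g w) s =
  (\sum_j g j * c j) * w s - contract g (wedge c w) s.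
Proof.
rewrite wedge_sumr mulr_suml /contract -sumrB; apply: eq_bigr => j _ /=.
by rewrite wedgeZ; ring.
Qed.

Section Vanishing.
Variables (c : T -> R) (M : set R).
Hypothesis idM : is_ideal M.

(** Vanishing of the Koszul cohomology group H^p(c; M/N), on representatives in M. *)
Definition koszul_exact (N : set R) p := forall w,
  (forall s, M (w s)) -> (forall s, size s = p.+1 -> N (wedge c w s)) ->
  exists2 v, forall s, M (v s) & forall s, size s = p -> N (w s - wedge c v s).

(** Induction on p, for all quotients M/N_i with N_i = N + (u_0 .. u_(i-1))M at once.
    Let f = u_i = sum_j g_j c_j and let w be a (p+1)-cocycle modulo N_i.  By the
    homotopy formula, f w is the coboundary of h = contract g w up to N_i, so h is a
    p-cocycle modulo N_(i+1) = N_i + fM.  By induction h is a coboundary plus f z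
    modulo N_i for some cochain z.  Taking coboundaries gives f w = f dz modulo N_i,
    and f can be cancelled because it is regular on M/N_i. *)
Lemma koszul_exact_regular N us p : is_ideal N -> N `<=` M ->
  regular_seq M N us ->
  (forall u, u \in us -> exists g, u = \sum_j g j * c j) ->
  (p < size us)%N -> koszul_exact N p.
Proof.
move=> idN NM [reg _] usc; pose B i := adjoin_mul M N (take i us).
have idB i : is_ideal (B i) by exact: adjoin_mul_ideal.
suff exB i : (i + p < size us)%N -> koszul_exact (B i) p.
  move=> lep w Mw Dw; have [|v Mv wv] := exB 0%N lep w Mw.
    by move=> s sp; apply: adjoin_mul_base; apply: Dw.
  exists v => // s /wv; apply: (adjoin_mul_min idN) => // u x.
  by rewrite take0.
(* In degree 0 a cocycle is an element killed by all the c_j, hence by u_i. *)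
elim: p i => [|p IHp] i lti w Mw Dw.
  exists (fun=> 0) => [s|s /size0nil -> /=]; first exact: (ideal0 idM).
  rewrite addn0 in lti; rewrite subr0; apply: reg => //.
  have [g ->] := usc _ (mem_nth 0 lti).
  rewrite mulr_suml; apply: (ideal_sum (idB i)) => j _.
  have := Dw [:: j] erefl; rewrite /= subr0 => /(idealM (idB i) (g j)).
  by rewrite mulrA.
have {}lti' : (i.+1 + p < size us)%N by rewrite addSnnS.
have {lti} lti : (i < size us)%N.
  by apply: leq_ltn_trans lti; rewrite leq_addr.
have [g fg] := usc _ (mem_nth 0 lti).
set f := us`_i in fg; pose hw := contract g w.
have Mhw s : M (hw s).
  by apply: ideal_sum => // j _; apply: idealM.
have hDw s : size s = p.+1 -> B i (contract g (wedge c w) s).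
  move=> sp; apply: (ideal_sum (idB i)) => j _; apply: (idealM (idB i)); apply: Dw.
  by rewrite /= sp.
have BS x : B i.+1 x <->
    exists2 y, B i y & exists2 z, M z & x = y + f * z.
  rewrite /B (take_nth 0 lti); split; first exact: adjoin_mul_rcons.
  move=> [y By [z Mz ->]]; apply: (idealD (adjoin_mul_ideal _ _ _)).
    move: By; apply: adjoin_mul_min => [||u t uus Mt].
    - exact: adjoin_mul_ideal.
    - exact: adjoin_mul_base.
    by apply: adjoin_mul_mul => //; rewrite mem_rcons inE uus orbT.
  by apply: adjoin_mul_mul => //; rewrite mem_rcons mem_head.
have [|v Mv hwv] := IHp i.+1 lti' hw Mhw.
  move=> s sp; apply/BS; exists (- contract g (wedge c w) s).
    by apply: (idealN (idB i)); apply: hDw.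
  by exists (w s) => //; rewrite /hw wedge_contract -fg addrC.
(* The default (0, 0) serves sequences of the wrong length, where nothing is known
   about hw; coboundaries in degree p.+1 do not see these values. *)
have dec s : exists y : R * R, size s = p ->
    [/\ B i y.1, M y.2 & hw s - wedge c v s = y.1 + f * y.2].
  have [sp|sp] := eqVneq (size s) p; last by exists (0, 0) => /eqP; rewrite (negPf sp).
  by have /BS[y By [z Mz yz]] := hwv s sp; exists (y, z).
have [/= yz yzP] := choice dec.
pose z s := if size s == p then (yz s).2 else 0.
exists z => [s|s sp].
  by rewrite /z; case: eqP => [/yzP[]//|_]; exact: (ideal0 idM).
apply: reg => //.
  apply: (idealB idM) => //; apply: (wedge_ideal idM) => j r _; apply: (idealM idM).
  by rewrite /z; case: eqP => [/yzP[]//|_]; exact: (ideal0 idM).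
have key : wedge c hw s = wedge c (fun r => (yz r).1) s + f * wedge c z s.
  rewrite -wedgeZ -wedgeD -[LHS]subr0 -(wedge_square c v s) -wedgeB.
  apply: eq_wedge => r; rewrite sp => -[rp].
  by rewrite /z rp eqxx; case: (yzP r rp).
have -> : f * (w s - wedge c z s) =
    contract g (wedge c w) s + wedge c (fun r => (yz r).1) s.
  rewrite mulrBr; apply/eqP; rewrite subr_eq -addrA -key wedge_contract -fg.
  by rewrite addrC subrK.
apply: (idealD (idB i)); first exact: hDw.
apply: (wedge_ideal (idB i)) => j r; rewrite sp => -[rp].
by apply: (idealM (idB i)); case: (yzP r rp).
Qed.

End Vanishing.

Section Volume.

(** The coefficients of the 1-form dx_k. *)
Definition dirac (k j : T) : R := (j == k)%:R.

(** The volume form on the variables ks, as the iterated product of the dx_k applied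
    to the unit cochain of degree 0. *)
Definition volume (ks : seq T) : seq T -> R :=
  foldr (fun k => wedge (dirac k)) (fun s => (s == [::])%:R) ks.

Lemma volume_cons k ks : volume (k :: ks) = wedge (dirac k) (volume ks).
Proof. by []. Qed.

Lemma wedge_dirac_volume ks k s : k \in ks -> wedge (dirac k) (volume ks) s = 0.
Proof.
elim: ks s => // k' ks IHks s; rewrite inE volume_cons => /orP[/eqP->|kks].
  exact: wedge_square.
rewrite wedge_anticomm -[RHS]oppr0; congr (- _).
by rewrite -(wedge0 (dirac k') s); apply: eq_wedge => r _; apply: IHks.
Qed.

Lemma volume_notin ks j s : j \notin ks -> j \in s -> volume ks s = 0.
Proof.
elim: ks s => [|k ks IHks] s; first by case: s.
rewrite inE negb_or volume_cons => /andP[jk jks] js.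
suff gen w : (forall r, j \in r -> w r = 0) -> wedge (dirac k) w s = 0.
  by apply: gen => r; apply: IHks.
elim: s js w => // i s IHs; rewrite inE => /orP[/eqP<-|js] w w0 /=.
  rewrite /dirac (negPf jk) mul0r sub0r -[RHS]oppr0 -[in RHS](wedge0 (dirac k) s).
  by congr (- _); apply: eq_wedge => r _; rewrite w0 ?mem_head.
rewrite w0 // mulr0 sub0r IHs ?oppr0 // => r jr.
by rewrite w0 // inE jr orbT.
Qed.

Lemma volume_self ks : uniq ks -> volume ks ks = 1.
Proof.
elim: ks => [|k ks IHks] //= /andP[kks uks].
rewrite /dirac eqxx mul1r IHks // -/(dirac k) -/(volume ks).
rewrite (@eq_wedge _ _ (fun=> 0)) ?wedge0 ?subr0 // => r _.
by rewrite (volume_notin kks) ?mem_head.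
Qed.

(** Only the part of a 1-form that involves variables outside ks survives
    multiplication by the volume form of ks.  This one identity provides both the
    cocycle condition and the values of the coboundaries used below. *)
Lemma wedge_volume c ks s :
  wedge c (volume ks) s = wedge (fun j => if j \in ks then 0 else c j) (volume ks) s.
Proof.
pose d k j := if k \in ks then c k * dirac k j else 0.
have -> : wedge c (volume ks) s =
    wedge (fun j => \sum_k d k j + (if j \in ks then 0 else c j)) (volume ks) s.
  congr (wedge _ _ _); apply: funext => j.
  case: (boolP (j \in ks)) => jks; last first.
    rewrite big1 ?add0r // => k _; rewrite /d; case: ifP => // kks.
    rewrite /dirac; case: eqP => [jk|]; last by rewrite mulr0.
    by rewrite jk kks in jks.
  rewrite addr0 (bigD1 j) //= /d jks /dirac eqxx mulr1 big1 ?addr0 // => k kj.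
  by rewrite eq_sym (negPf kj) mulr0 if_same.
rewrite wedgeDl wedge_suml big1 ?add0r // => k _.
case: (boolP (k \in ks)) => kks.
  have -> : d k = fun j => c k * dirac k j by apply: funext => j; rewrite /d kks.
  by rewrite wedgeZl wedge_dirac_volume ?mulr0.
have -> : d k = fun j => 0 * dirac k j.
  by apply: funext => j; rewrite /d (negPf kks) mul0r.
by rewrite wedgeZl mul0r.
Qed.

End Volume.

End Koszul.

(** * Monomial ideals *)

Section MonomialIdeals.
Local Open Scope classical_set_scope.
Local Open Scope ring_scope.
Variables (K : fieldType) (n : nat).
Local Notation S := {mpoly K[n]}.
Implicit Types (E F : set 'X_{1..n}) (e a b : 'X_{1..n}) (f g : S).

Definition upclosed E := forall a b, E a -> E (a + b)%MM.

(** Monomial ideals are handled through their sets of exponents. *)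
Definition monideal E : set S := [set f | forall e, e \in msupp f -> E e].

Lemma monidealX E e : monideal E 'X_[e] <-> E e.
Proof.
split=> [|Ee a]; first by apply; rewrite msuppX mem_head.
by rewrite msuppX inE => /eqP->.
Qed.

Lemma monideal_coef0 E f e : monideal E f -> ~ E e -> f@_e = 0.
Proof. by move=> Ef nEe; apply: memN_msupp_eq0; apply/negP => /Ef. Qed.

Lemma monideal_ideal E : upclosed E -> is_ideal (monideal E).
Proof.
move=> upE; split=> [e|f g Ef Eg e|f g Eg e]; first by rewrite msupp0.
  by move=> /msuppD_le; rewrite mem_cat => /orP[/Ef|/Eg].
move=> /msuppM_le/allpairsP[[a b] /= [_ /Eg Eb ->]].
by rewrite addmC; apply: upE.
Qed.

(** Statements closed under addition need only be checked on the terms c x^e with e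
    in E. *)
Lemma monideal_ind E (P : S -> Prop) :
  P 0 -> (forall f g, P f -> P g -> P (f + g)) ->
  (forall c e, E e -> P (c *: 'X_[e])) -> forall f, monideal E f -> P f.
Proof.
move=> P0 PD PX f Ef; rewrite (mpolyE f); rewrite big_seq_cond.
by elim/big_ind: _ => // e /andP[/Ef Ee _]; apply: PX.
Qed.

Lemma monideal_sub_ideal E (I : set S) :
  is_ideal I -> (forall e, E e -> I 'X_[e]) -> monideal E `<=` I.
Proof.
move=> idI EI; apply: monideal_ind => [|f g|c e /EI Ie].
- exact: (ideal0 idI).
- exact: (idealD idI).
- by rewrite -mul_mpolyC; apply: (idealM idI).
Qed.

Lemma ideal_gen_monideal (A : set S) E : upclosed E -> A `<=` monideal E ->
  (forall e, E e -> ideal_gen A 'X_[e]) -> ideal_gen A = monideal E.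
Proof.
move=> upE AE EA; apply/seteqP; split.
  by apply: ideal_gen_min => //; apply: monideal_ideal.
by apply: monideal_sub_ideal => //; apply: ideal_gen_ideal.
Qed.

Lemma monomial_idealP (I : set S) :
  is_monomial_ideal I <-> exists2 E, upclosed E & I = monideal E.
Proof.
split=> [[A Amon ->]|[E upE ->]]; last first.
  exists [set u | exists2 e, E e & u = 'X_[e]]; first by move=> u [e _ ->]; exists e.
  apply/esym/ideal_gen_monideal => // [_ [e Ee ->]|e Ee]; first exact/monidealX.
  by apply: ideal_gen_gen; exists e.
have idA := ideal_gen_ideal A.
exists [set e | ideal_gen A 'X_[e]].
  by move=> a b Aa; rewrite /= mpolyXD; apply: (idealMr idA).
apply: ideal_gen_monideal => [a b Aa|u Au|//].
  by rewrite /= mpolyXD; apply: (idealMr idA).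
have [e ue] := Amon u Au; rewrite ue; apply/monidealX; rewrite /= -ue.
exact: ideal_gen_gen.
Qed.

Lemma monidealI E F : monideal E `&` monideal F = monideal (E `&` F).
Proof.
apply/seteqP; split=> [f [Ef Ff] e ef|f EFf]; first by split; [apply: Ef|apply: Ff].
by split=> e /EFf[].
Qed.

Lemma upclosedI E F : upclosed E -> upclosed F -> upclosed (E `&` F).
Proof. by move=> uE uF a b [Ea Fa]; split; [apply: uE|apply: uF]. Qed.

Lemma monideal_neq0 E : monideal E <> [set 0] -> exists e, E e.
Proof.
move=> E0; apply: contrapT => nE; apply: E0; apply/seteqP; split=> [f Ef|_ -> e].
  by apply/mpolyP => e; rewrite mcoeff0 (monideal_coef0 Ef) // => Ee; apply: nE; exists e.
by rewrite msupp0.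
Qed.

Lemma monideal_neqT E : upclosed E -> monideal E <> [set: S] -> ~ E 0%MM.
Proof.
move=> upE ET E0; apply: ET; apply/seteqP; split=> // f _ e _.
by rewrite -[e]add0m; apply: upE.
Qed.

(** * Bounds on the length of regular sequences *)

Lemma irrelevant_idealP u : irrelevant_ideal u ->
  exists g : 'I_n -> S, u = \sum_j g j * 'X_j.
Proof.
pose C : set S := [set u | exists g : 'I_n -> S, u = \sum_j g j * 'X_j].
suff: @irrelevant_ideal K n `<=` C by exact.
apply: ideal_gen_min => [|_ [i _ <-]]; last first.
  exists (fun j => (j == i)%:R); rewrite (bigD1 i) //= eqxx mul1r big1 ?addr0 //.
  by move=> j /negPf->; rewrite mul0r.
split.
- by exists (fun=> 0); rewrite big1 // => j _; rewrite mul0r.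
- move=> _ _ [g ->] [h ->]; exists (fun j => g j + h j).
  by rewrite -big_split; apply: eq_bigr => j _; rewrite mulrDl.
- move=> a _ [g ->]; exists (fun j => a * g j).
  by rewrite mulr_sumr; apply: eq_bigr => j _; rewrite mulrA.
Qed.

Lemma mcoeffXM j g e :
  ('X_j * g)@_e = if (U_(j) <= e)%MM then g@_(e - U_(j)) else 0.
Proof.
rewrite {1}(mpolyE g) mulr_sumr raddf_sum /=.
under eq_bigr do rewrite -scalerAr mcoeffZ -mpolyXD mcoeffX.
case: ifP => je; last first.
  rewrite big1_seq // => a _; case: eqP => [ea|]; last by rewrite mulr0.
  by rewrite -ea lem_addr in je.
under eq_bigr => a _.
  have -> : ((U_(j) + a)%MM == e) = (a == (e - U_(j))%MM).
    by apply/eqP/eqP => [<-|->]; [rewrite addmC addmK|rewrite addmC submK].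
  over.
have [ge|gn] := boolP ((e - U_(j))%MM \in msupp g).
  rewrite (bigD1_seq _ ge) ?msupp_uniq //= eqxx mulr1 big1 ?addr0 // => a /negPf->.
  by rewrite mulr0.
rewrite (memN_msupp_eq0 gn) big1_seq // => a /andP[_ ag].
by case: eqP => [ae|]; [rewrite -ae ag in gn|rewrite mulr0].
Qed.

Local Notation X := (fun j : 'I_n => 'X_j : S).

(** Criterion for a p-cocycle w to bound the length of regular sequences by p.  The
    last two hypotheses prevent w from being a coboundary: the value of a coboundary
    of an M-valued cochain is a combination of the x_j with coefficients in M, so the
    coefficient of x^e in it vanishes as soon as no x^e / x_j lies in M. *)
Lemma regular_seq_size_le E (us : seq S) p (w : seq 'I_n -> S) s0 e :
  upclosed E -> regular_seq (monideal E) [set 0] us ->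
  (forall u, u \in us -> irrelevant_ideal u) ->
  (forall s, monideal E (w s)) -> (forall s, size s = p.+1 -> wedge X w s = 0) ->
  size s0 = p -> (w s0)@_e != 0 ->
  (forall j, (U_(j) <= e)%MM -> ~ E (e - U_(j))%MM) -> (size us <= p)%N.
Proof.
move=> upE reg us_irr Ew cocycle s0p wse emin.
rewrite leqNgt; apply/negP => ltp.
have idE := monideal_ideal upE.
have [|||v Ev wv] :=
  koszul_exact_regular (c := X) idE (set0_ideal S) _ reg _ ltp Ew.
- by move=> _ ->; apply: (ideal0 idE).
- by move=> u /us_irr/irrelevant_idealP.
- exact: cocycle.
have /eqP := wv _ s0p; rewrite subr_eq0 => /eqP ws0.
case/eqP: wse; rewrite ws0.
elim: s0 v Ev {s0p wv ws0} => [|j s IHs] v Ev /=; first by rewrite mcoeff0.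
rewrite mcoeffB IHs ?subr0; last by move=> r; apply: Ev.
rewrite mcoeffXM; case: ifP => // /emin nE; exact: monideal_coef0 (Ev _) nE.
Qed.

Lemma exists_minimal_exponent E : (exists e, E e) ->
  exists2 u, E u & forall j, (U_(j) <= u)%MM -> ~ E (u - U_(j))%MM.
Proof.
move=> [e Ee].
have exd : exists d, `[< exists2 a, E a & mdeg a = d >].
  by exists (mdeg e); apply/asboolP; exists e.
case: (ex_minnP exd) => d /asboolP[u Eu ud] dmin; exists u => // j ju Euj.
have := dmin (mdeg (u - U_(j))%MM).
have -> : `[< exists2 a, E a & mdeg a = mdeg (u - U_(j))%MM >] = true.
  by apply/asboolP; exists (u - U_(j))%MM.
move=> /(_ isT); rewrite -ud -[in mdeg u](submK ju) mdegD mdeg1 addn1.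
by rewrite ltnn.
Qed.

Lemma monidealXM E u f : upclosed E -> E u -> monideal E ('X_[u] * f).
Proof. by move=> upE Eu; apply: (idealMr (monideal_ideal upE)); apply/monidealX. Qed.

(** The class of u dx_1 ... dx_n, for a minimal generator u, is not zero in top
    degree.  The sharp bound is irrelevant: what matters is that the depth of an
    ideal is a true maximum. *)
Lemma regular_seq_size_le_nvars E (us : seq S) :
  upclosed E -> (exists e, E e) -> regular_seq (monideal E) [set 0] us ->
  (forall u, u \in us -> irrelevant_ideal u) -> (size us <= n)%N.
Proof.
move=> upE /exists_minimal_exponent[u Eu umin] reg us_irr.
pose ks := enum 'I_n.
apply: (regular_seq_size_le (w := fun s => 'X_[u] * volume S ks s) (s0 := ks)
  upE reg us_irr _ _ _ _ umin).
- by move=> s; apply: monidealXM.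
- move=> s _; rewrite wedgeZ wedge_volume (_ : wedge _ _ _ = 0) ?mulr0 //.
  apply: (wedge_ideal (I := [set 0]) (set0_ideal S)) => j r _.
  by rewrite mem_enum mul0r.
- exact: size_enum_ord.
- by rewrite volume_self ?enum_uniq // mulr1 mcoeffX eqxx oner_neq0.
Qed.

(** The exponents of the monomials in the ideal generated by the variables in Y. *)
Definition meets (Y : {set 'I_n}) : set 'X_{1..n} :=
  [set e | exists2 j, j \in Y & e j != 0%N].

Lemma upclosed_meets Y : upclosed (meets Y).
Proof.
by move=> a b [j Yj aj]; exists j => //; rewrite mnmDE addn_eq0 negb_and aj.
Qed.

(** Membership in E ignores the coordinates in Y: the ideal is extended from the
    polynomial ring in the other variables. *)
Definition indep E (Y : {set 'I_n}) :=
  forall a b, (forall j, j \notin Y -> a j = b j) -> E a -> E b.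

Lemma indepS E (W Y : {set 'I_n}) : W \subset Y -> indep E Y -> indep E W.
Proof.
move=> WY EY a b ab; apply: EY => j jY; apply: ab.
by apply: contra jY; apply: (fintype.subsetP WY).
Qed.

Lemma indep_addU E Y e j : indep E Y -> j \in Y -> E (e + U_(j))%MM -> E e.
Proof.
move=> EY Yj; apply: EY => i iY; rewrite mnmDE mnm1E.
by case: eqP iY => [<-|_]; rewrite ?Yj ?addn0.
Qed.

(** Let M be the intersection of an ideal extended from the variables outside Y with
    the ideal (Y), and let u be a monomial of the former that is minimal for division
    by variables.  The cochain k = u vol, for the volume form of the variables outside
    Y, has values in the big ideal but not in (Y).  Its coboundary is
    sum_(y in Y) u y dy vol up to sign, which has values in M.  The coefficient of u y
    shows that it is not a coboundary of an M-valued cochain: u y / y = u is not in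
    (Y), and u y / x_j is not in the big ideal. *)
Lemma regular_seq_meets_size_le E (Y : {set 'I_n}) (us : seq S) :
  upclosed E -> (exists e, E e) -> (exists y, y \in Y) ->
  indep E Y -> regular_seq (monideal (E `&` meets Y)) [set 0] us ->
  (forall u, u \in us -> irrelevant_ideal u) -> (size us <= #|~: Y|.+1)%N.
Proof.
move=> upE /exists_minimal_exponent[u Eu umin] [y Yy] EY reg us_irr.
pose ks := enum (~: Y).
have upN : upclosed (E `&` meets Y) by apply: upclosedI => //; apply: upclosed_meets.
have idY := monideal_ideal (@upclosed_meets Y).
(* A minimal exponent has no coordinate in Y, since such a coordinate could be
   lowered without leaving E. *)
have uY j : j \in Y -> u j = 0%N.
  move=> Yj; apply/eqP; apply: contrapT => /negP; rewrite -lep1mP => ju.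
  by apply: (umin j ju); apply: (indep_addU EY Yj); rewrite submK.
have yks : y \notin ks by rewrite mem_enum inE negbK.
pose k := fun s => 'X_[u] * volume S ks s.
apply: (regular_seq_size_le (w := wedge X k) (s0 := y :: ks) (e := (u + U_(y))%MM)
  upN reg us_irr).
- move=> s; rewrite wedgeZ -monidealI; split; first exact: monidealXM.
  apply: (idealM idY); rewrite wedge_volume.
  apply: (wedge_ideal idY) => j r _; rewrite mem_enum inE.
  have [Yj|nYj] := boolP (j \in Y); last by rewrite mul0r; apply: (ideal0 idY).
  apply: (idealMr idY); apply/monidealX; exists j => //.
  by rewrite mnm1E eqxx.
- by move=> s _; apply: wedge_square.
- by rewrite /= -cardE.
- rewrite /= /k volume_self ?enum_uniq // mulr1 (@eq_wedge _ _ _ _ (fun=> 0)).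
    by rewrite wedge0 subr0 -mpolyXD addmC mcoeffX eqxx oner_neq0.
  by move=> r _; rewrite (volume_notin _ yks) ?mem_head ?mulr0.
- move=> j; rewrite lep1mP mnmDE mnm1E => je [Ej [i Yi]].
  have [jy|jy] := eqVneq y j.
    by rewrite -jy addmK uY.
  rewrite (negPf jy) addn0 in je.
  have ju : (U_(j) <= u)%MM by rewrite lep1mP.
  move=> _; apply: (umin j ju); apply: (indep_addU EY Yy).
  by rewrite addmC addmBA // addmC.
Qed.

End MonomialIdeals.

Arguments monideal K {n} E _.

(** * Stanley decompositions as partitions into boxes *)

Section Boxes.
Local Open Scope classical_set_scope.
Local Open Scope ring_scope.
Variables (K : fieldType) (n : nat).
Local Notation S := {mpoly K[n]}.
Implicit Types (E : set 'X_{1..n}) (a e : 'X_{1..n}) (Z : {set 'I_n}).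

(** The exponents of the monomials in x^a K[Z]. *)
Definition box a Z e : bool :=
  [forall j, if j \in Z then (a j <= e j)%N else e j == a j].

Lemma boxP a Z e :
  reflect (forall j, if j \in Z then (a j <= e j)%N else e j == a j) (box a Z e).
Proof. exact: forallP. Qed.

Lemma box_corner a Z : box a Z a.
Proof. by apply/boxP => j; rewrite leqnn eqxx if_same. Qed.

Lemma box_le a Z e : box a Z e -> (a <= e)%MM.
Proof.
move=> /boxP ae; apply/mnm_lepP => j; have := ae j.
by case: ifP => // _ /eqP->.
Qed.

(** The coefficient of a homogeneous generator is invertible, so a Stanley space is
    spanned by the monomials of a box. *)
Lemma box_stanley_space (c : K) a Z : c != 0 ->
  stanley_space (c *: 'X_[a]) Z = monideal K (box a Z).
Proof.
move=> c0; apply/seteqP; split=> [_ [f Zf <-] e|].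
  rewrite -scalerAl => /msuppZ_le/msuppM_le/allpairsP[[a' b] /= [+ bf ->]].
  rewrite msuppX inE => /eqP->; apply/boxP => j; rewrite mnmDE.
  have := Zf b bf j; case: ifP => [_ _|jZ]; first exact: leq_addr.
  by have [->|_ /(_ isT)//] := eqVneq (b j) 0%N; rewrite addn0.
apply: monideal_ind => [|_ _ [f Zf <-] [g Zg <-]|d e aZe].
- by exists 0; rewrite ?mulr0 // => b; rewrite msupp0.
- exists (f + g); rewrite ?mulrDr // => b /msuppD_le.
  by rewrite mem_cat => /orP[/Zf|/Zg].
- exists (d / c *: 'X_[e - a]).
    move=> b /msuppZ_le; rewrite msuppX inE => /eqP-> j; rewrite mnmBE.
    move/boxP/(_ j): aZe; case: ifP => // _ /eqP->.
    by rewrite subnn eqxx.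
  rewrite -scalerAl -scalerAr scalerA -mpolyXD mulrCA divff // mulr1.
  by rewrite addmC submK // (box_le aZe).
Qed.

Definition box_partition (F : finType) (P : {set F}) (a : F -> 'X_{1..n})
    (Z : F -> {set 'I_n}) E : Prop :=
  [/\ forall f, f \in P -> box (a f) (Z f) `<=` E,
      forall e, E e -> exists2 f, f \in P & box (a f) (Z f) e
    & forall f f' e, f \in P -> f' \in P ->
        box (a f) (Z f) e -> box (a f') (Z f') e -> f = f'].

Lemma box_sum_eq0 (F : finType) (P : {set F}) (a : F -> _) (Z : F -> _) E (w : F -> S) :
  box_partition P a Z E -> (forall f, f \in P -> monideal K (box (a f) (Z f)) (w f)) ->
  \sum_(f in P) w f = 0 -> forall f, f \in P -> w f = 0.
Proof.
move=> [_ _ disj] Bw w0 f Pf; apply/mpolyP => e; rewrite mcoeff0.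
have [fe|] := boolP (box (a f) (Z f) e); last by move/negP/(monideal_coef0 (Bw f Pf)).
have := congr1 (mcoeff e) w0; rewrite mcoeff0 raddf_sum (bigD1 f) //= big1 ?addr0 //.
move=> f' /andP[Pf' ff']; apply: (monideal_coef0 (Bw f' Pf')) => fe'.
by case/eqP: ff'; apply: (disj _ _ e).
Qed.

Lemma sdepth_le_nvars (I : set S) d :
  (exists (t : nat) (m : 'I_t -> S) (Z : 'I_t -> {set 'I_n}),
    stanley_decomposition I m Z /\ sdepth_decomposition Z = d) -> (d <= n)%N.
Proof.
move=> [t [m [Z [_ <-]]]]; rewrite /sdepth_decomposition.
by elim/big_ind: _ => // [x y xn yn|i _]; [by rewrite geq_min xn|];
  rewrite -[n in (_ <= n)%N]card_ord max_card.
Qed.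

(** A partition into boxes gives a Stanley decomposition.  The boxes are indexed by
    a subset of a finite type, so that boxes may be named by whatever data describe
    them. *)
Lemma sdepth_ge (F : finType) (P : {set F}) (a : F -> _) (Z : F -> _) E k : (k <= n)%N ->
  box_partition P a Z E -> (forall f, f \in P -> (k <= #|Z f|)%N) ->
  (k <= sdepth (monideal K E))%N.
Proof.
move=> kn part Zk; have [PE cov disj] := part.
pose m (i : 'I_#|P|) : S := 1 *: 'X_[a (enum_val i)].
pose ZZ (i : 'I_#|P|) := Z (enum_val i).
have mZE i : stanley_space (m i) (ZZ i) = monideal K (box (a (enum_val i)) (ZZ i)).
  by rewrite box_stanley_space ?oner_neq0.
apply: (@leq_trans (sdepth_decomposition ZZ)).
  rewrite /sdepth_decomposition; elim/big_ind: _ => // [x y xk yk|i _].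
    by rewrite leq_min xk.
  by apply: Zk; apply: enum_valP.
apply: (le_nat_max (b := n)); first exact: sdepth_le_nvars.
exists #|P|, m, ZZ; split=> //; split.
- move=> i; split; last by exists 1, (a (enum_val i)).
  rewrite /m scale1r; apply/monidealX/(PE _ (enum_valP i)); exact: box_corner.
- move=> i f _ /eqP; rewrite /m scale1r mulf_eq0 => /orP[/eqP X0|/eqP//].
  have := congr1 (mcoeff (a (enum_val i))) X0.
  by rewrite mcoeffX eqxx mcoeff0 => /eqP; rewrite oner_eq0.
- apply/seteqP; split.
    apply: monideal_ind => [|_ _ [w /= Bw <-] [w' /= Bw' <-]|c e Ee].
    + exists (fun=> 0); last by rewrite big1.
      by move=> i; rewrite mZE => e; rewrite msupp0.
    + exists (fun i => w i + w' i); last by rewrite big_split.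
      move=> i; move: (Bw i) (Bw' i); rewrite !mZE => wi w'i e /msuppD_le.
      by rewrite mem_cat => /orP[/wi|/w'i].
    + have [f Pf fe] := cov e Ee.
      pose i := enum_rank_in Pf f.
      have fi : enum_val i = f by apply: enum_rankK_in.
      exists (fun j => if j == i then c *: 'X_[e] else 0).
        move=> j; rewrite mZE; case: eqP => [->|_] b; last by rewrite msupp0.
        by move=> /msuppZ_le; rewrite msuppX inE => /eqP->; rewrite /ZZ fi.
      by rewrite (bigD1 i) //= eqxx big1 ?addr0 // => j /negPf->.
  move=> _ [w /= Bw <-]; elim/big_ind: _ => [e|f g Ef Eg e|i _ e].
  + by rewrite msupp0.
  + by move=> /msuppD_le; rewrite mem_cat => /orP[/Ef|/Eg].
  + by move: (Bw i); rewrite mZE => Bi /Bi; apply: (PE _ (enum_valP i)).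
- move=> w Bw w0 i.
  apply: (@box_sum_eq0 _ [set: 'I_#|P|]%SET (a \o enum_val) ZZ E w) => //=.
  + split=> [j _|e /cov[f Pf fe]|j j' e _ _ je j'e].
    * exact: (PE _ (enum_valP j)).
    * by exists (enum_rank_in Pf f); [rewrite inE|rewrite /ZZ /= enum_rankK_in].
    * by apply/enum_val_inj/(disj _ _ e) => //; apply: enum_valP.
  + by move=> j _; rewrite -mZE.
  + by rewrite -[RHS]w0; apply: eq_bigl => j; rewrite inE.
  + by rewrite inE.
Qed.

(** Conversely, every Stanley decomposition of a monomial ideal comes from a partition
    into boxes: freeness makes the generators nonzero terms, and directness of the
    sum makes the boxes disjoint. *)
Lemma sdepth_boxes E : (0 < sdepth (monideal K E))%N ->
  exists (t : nat) (a : 'I_t -> 'X_{1..n}) (Z : 'I_t -> {set 'I_n}),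
    box_partition [set: 'I_t]%SET a Z E /\
    forall i, (sdepth (monideal K E) <= #|Z i|)%N.
Proof.
move=> /nat_max_attained[t [m [Z [[Im free span direct] dZ]]]].
have hom i : exists ca : K * 'X_{1..n}, m i = ca.1 *: 'X_[ca.2] /\ ca.1 != 0.
  have [_ [c [a mi]]] := Im i; exists (c, a); split=> //=.
  apply/negP => /eqP c0.
  have : (1 : S) = 0; last by move/eqP; rewrite oner_eq0.
  (* If m i were 0 then 1 would be a relation. *)
  apply: (free i); last by rewrite mulr1 mi c0 scale0r.
  by move=> e; rewrite -mpolyC1 msupp1 inE => /eqP-> j; rewrite mnm0E.
have [ca caP] := choice hom.
have mZE i : stanley_space (m i) (Z i) = monideal K (box (ca i).2 (Z i)).
  by have [-> c0] := caP i; rewrite box_stanley_space.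
have single i w : stanley_space (m i) (Z i) w -> forall j,
    stanley_space (m j) (Z j) (if j == i then w else 0).
  move=> Bw j; case: eqP => [->//|_].
  by rewrite mZE => e; rewrite msupp0.
exists t, (fun i => (ca i).2), Z; split; last first.
  move=> i; rewrite /sdepth -dZ /sdepth_decomposition.
  elim: (index_enum _) (mem_index_enum i) => // j r IHr.
  rewrite inE big_cons geq_min => /orP[/eqP<-|/IHr->]; first by rewrite leqnn.
  by rewrite orbT.
split=> [i _ e ie|e /(monidealX K)|i i' e _ _ ie i'e].
- apply/(monidealX K); rewrite span.
  exists (fun j => if j == i then 'X_[e] else 0).
    by apply: single; rewrite mZE; apply/monidealX.
  by rewrite (bigD1 i) //= eqxx big1 ?addr0 // => j /negPf->.
- rewrite span => -[w /= Bw wX].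
  apply: contrapT => nocov; have := congr1 (mcoeff e) wX.
  rewrite mcoeffX eqxx raddf_sum big1 => [/esym/eqP|i _]; first by rewrite oner_eq0.
  move: (Bw i); rewrite mZE => /monideal_coef0; apply => ie.
  by apply: nocov; exists i; rewrite ?inE.
- apply: contrapT => ii'.
  pose w j : S := (if j == i then 'X_[e] else 0) - (if j == i' then 'X_[e] else 0).
  have Bw j : stanley_space (m j) (Z j) (w j).
    rewrite mZE => b /msuppB_le; rewrite mem_cat => /orP[].
      case: eqP => [->|_]; last by rewrite msupp0.
      by rewrite msuppX inE => /eqP->.
    case: eqP => [->|_]; last by rewrite msupp0.
    by rewrite msuppX inE => /eqP->.
  have w0 : \sum_j w j = 0.
    rewrite sumrB (bigD1 i) //= eqxx big1 => [|j /negPf->//].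
    rewrite (bigD1 i') //= eqxx big1 => [|j /negPf->//].
    by rewrite subrr.
  have := congr1 (mcoeff e) (direct w Bw w0 i).
  rewrite /w eqxx; case: eqP => // _; rewrite subr0 mcoeffX eqxx mcoeff0.
  by apply/eqP; rewrite oner_eq0.
Qed.

End Boxes.

(** * Truncation of exponents *)

Section Truncation.
Local Open Scope classical_set_scope.
Variable n : nat.
Implicit Types (E : set 'X_{1..n}) (e a b : 'X_{1..n}) (G t : nat).

Definition trunc G e : 'X_{1..n} := [multinom minn (e j) G | j < n].

Lemma upclosed_le E a b : upclosed E -> (a <= b)%MM -> E a -> E b.
Proof. by move=> upE ab /upE; rewrite -[b](submK ab) addmC; apply. Qed.

Lemma trunc_le G e : (trunc G e <= e)%MM.
Proof. by apply/mnm_lepP => j; rewrite mnmE geq_minl. Qed.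

Let upd e j t : 'X_{1..n} := [multinom if i == j then t else e i | i < n].

(** A form of Dickson's lemma: membership in an upward closed set of exponents is
    detected after cutting all coordinates at a large constant G.  The induction is
    on the number of coordinates that E depends on.  Let E_t be the slice of E at the
    value t of a chosen coordinate j.  The slices increase with t, and their union is
    already reached at some T: by induction the union is determined by finitely many
    truncated exponents.  The constant for E is the maximum of T and of the constants
    for the union and for the slices below T. *)
Lemma upclosed_trunc E : upclosed E -> exists G, forall e, E e -> E (trunc G e).
Proof.
move=> upE.
suff gen (js : seq 'I_n) F : upclosed F ->
    (forall e e', {in js, e =1 e'} -> F e -> F e') ->
    exists G, forall e, F e -> F (trunc G e).
  apply: (gen (enum 'I_n)) => // e e' ee'; suff -> : e = e' by [].
  by apply/mnmP => j; apply: ee'; rewrite mem_enum.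
elim: js F => [|j js IHjs] F upF Fjs; first by exists 0 => e; apply: Fjs.
have upd_le e e' t t' : (e <= e')%MM -> t <= t' -> (upd e j t <= upd e' j t')%MM.
  move=> /mnm_lepP ee' tt'; apply/mnm_lepP => i; rewrite !mnmE.
  by case: eqP.
pose slice t : set 'X_{1..n} := [set e | F (upd e j t)].
have up_slice t : upclosed (slice t).
  by move=> a b; apply: (upclosed_le upF); apply: upd_le => //; apply: lem_addr.
have slice_js t e e' : {in js, e =1 e'} -> slice t e -> slice t e'.
  move=> ee'; apply: Fjs => i; rewrite inE !mnmE.
  by case: eqP => //= _ /ee'.
have [|e e' ee' [t te]|Ginf GinfP] := IHjs (fun e => exists t, slice t e).
- by move=> a b [t ta]; exists t; apply: up_slice.
- by exists t; apply: slice_js te.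
have [Gs GsP] := choice (fun t => IHjs _ (up_slice t) (@slice_js t)).
pose mono (c : {ffun 'I_n -> 'I_Ginf.+1}) : 'X_{1..n} := [multinom c i : nat | i < n].
have exT c : exists T, (exists t, slice t (mono c)) -> slice T (mono c).
  have [[t tc]|nt] := pselect (exists t, slice t (mono c)); first by exists t.
  by exists 0.
have [Ts TsP] := choice exT.
pose T := \max_c Ts c.
have sliceT e t : slice t e -> slice T (trunc Ginf e).
  move=> te; have {te} : exists t, slice t (trunc Ginf e) by apply: GinfP; exists t.
  have -> : trunc Ginf e = mono [ffun i => inord (minn (e i) Ginf)].
    by apply/mnmP => i; rewrite !mnmE ffunE inordK // ltnS geq_minr.
  move=> /TsP; apply: (upclosed_le upF); apply: upd_le; first exact: lepm_refl.
  exact: leq_bigmax.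
pose G := maxn T (maxn Ginf (\max_(t < T) Gs t)).
exists G => e Fe.
have Fej : slice (e j) e.
  by apply: Fjs Fe => i _; rewrite mnmE; case: eqP => // ->.
(* Above T the slice is the union, so the coordinate j may be lowered to T. *)
have [Te|eT] := leqP T (e j).
  apply: (upclosed_le upF) (sliceT _ _ Fej); apply/mnm_lepP => i; rewrite !mnmE.
  case: eqP => [->|_]; first by rewrite leq_min Te leq_maxl.
  by rewrite leq_min geq_minl (leq_trans (geq_minr _ _)) // /G !leq_max leqnn orbT.
apply: (upclosed_le upF) (GsP _ _ Fej); apply/mnm_lepP => i; rewrite !mnmE.
case: eqP => [->|_]; first by rewrite leq_min leqnn (leq_trans (ltnW eT)) // leq_maxl.
rewrite leq_min geq_minl (leq_trans (geq_minr _ _)) //.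
rewrite /G !leq_max (leq_bigmax (Ordinal eT) : Gs (e j) <= _) !orbT //.
Qed.

End Truncation.

(** * The Stanley depth of an ideal cut out by fresh variables *)

Section SdepthMeets.
Local Open Scope classical_set_scope.
Variables (K : fieldType) (n : nat).
Implicit Types (E : set 'X_{1..n}) (e : 'X_{1..n}) (Y : {set 'I_n}).

(** The box of an exponent e is determined by the truncation of e outside Y, and by
    the interval [L, U] of its support in Y.  Its corner is the truncation outside Y
    and the indicator of L on Y; its free directions are the coordinates outside Y
    that were cut, and U.  Hence there are at least #|U| >= k of them. *)
Lemma sdepth_meets_ge E Y k : upclosed E -> indep E Y -> top_heavy Y k -> (k <= n)%N ->
  (k <= sdepth (monideal K (E `&` meets Y)))%N.
Proof.
move=> upE EY [L [U LU]] kn.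
have [G GP] := upclosed_trunc upE.
pose supp e := [set j in Y | e j != 0%N]%SET.
have suppY e : meets Y e <-> nonempty_subsets Y (supp e).
  split=> [[j Yj ej]|/andP[_ /set0Pn[j]]]; last by rewrite inE => /andP[Yj ej]; exists j.
  apply/andP; split; first by apply/fintype.subsetP => i; rewrite inE => /andP[].
  by apply/set0Pn; exists j; rewrite inE Yj.
(* Coordinates of a corner are at most max(1, G), so they are below G.+2. *)
pose corner e : {ffun 'I_n -> 'I_G.+2} :=
  [ffun j => inord (if j \in Y then j \in L (supp e) : nat else minn (e j) G)].
pose free e := ([set j | (j \notin Y) && (G <= e j)%N] :|: U (supp e))%SET.
have cornerE e j :
    corner e j = (if j \in Y then j \in L (supp e) : nat else minn (e j) G) :> nat.
  rewrite ffunE inordK //; case: ifP => _; first by case: (_ \in _).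
  by rewrite ltnS (leq_trans (geq_minr _ _)).
have freeE e j : meets Y e -> (j \in free e) =
    if j \in Y then j \in U (supp e) else (G <= e j)%N.
  move=> /suppY/LU[_ _ /fintype.subsetP UY _ _]; rewrite inE inE.
  case: ifP => jY //=; rewrite orbC.
  by case: (boolP (j \in U (supp e))) => // /UY; rewrite jY.
pose F := ({ffun 'I_n -> 'I_G.+2} * {set 'I_n})%type.
pose fa (f : F) : 'X_{1..n} := [multinom f.1 j : nat | j < n].
pose label e : F := (corner e, free e).
pose N := E `&` meets Y.
have in_box e : N e -> box (fa (label e)) (free e) e.
  move=> [Ee Me];
  have /LU[/fintype.subsetP LA /fintype.subsetP AU UY kU int] := (suppY e).1 Me.
  apply/boxP => j; rewrite mnmE cornerE freeE //; have [jY|jY] := boolP (j \in Y).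
    have [jU|jU] := boolP (j \in U _).
      have [/LA|//] := boolP (j \in L _).
      by rewrite inE jY lt0n.
    have jA : j \notin supp e by apply: contra jU; apply: AU.
    have jL : j \notin L (supp e) by apply: contra jA; apply: LA.
    by move: jA; rewrite inE jY /= negbK (negPf jL).
  by case: leqP => // _; rewrite eqxx.
(* An exponent in the box of e has its support between the bottom and the top of the
   same interval, and the same truncation outside Y, hence the same box. *)
have box_stable e e' : N e -> box (fa (label e)) (free e) e' ->
    N e' /\ label e' = label e.
  move=> [Ee Me] /boxP box_e'.
  have /LU[/fintype.subsetP LA /fintype.subsetP AU /fintype.subsetP UY kU int] :=
    (suppY e).1 Me.
  have [||] := int (supp e').
  - apply/fintype.subsetP => j jL; have jU := AU _ (LA _ jL); have jY := UY _ jU.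
    have := box_e' j; rewrite freeE // jY jU mnmE cornerE jY jL inE jY lt0n.
    by [].
  - apply/fintype.subsetP => j; rewrite inE => /andP[jY e'j].
    have := box_e' j; rewrite freeE // jY mnmE cornerE jY.
    case: ifP => // jU; case: (boolP (j \in L _)) => [/LA/AU|_]; first by rewrite jU.
    by rewrite (negPf e'j).
  move=> supp' eL eU.
  have Me' : meets Y e' by apply/suppY.
  have minE j : j \notin Y -> minn (e' j) G = minn (e j) G.
    move=> /negPf jY; have := box_e' j; rewrite freeE // jY mnmE cornerE jY.
    case: leqP => [_ /minn_idPr//|eG /eqP->]; exact/minn_idPl/ltnW.
  split.
    split=> //; apply: (upclosed_le upE (trunc_le G e')).
    by apply: EY (GP _ Ee) => j jY; rewrite !mnmE minE.
  congr pair.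
    by apply/ffunP => j; apply/ord_inj; rewrite !cornerE eL; case: ifP => // /negbT/minE.
  apply/setP => j; rewrite !freeE // eU; case: ifP => // /negbT/minE me.
  by apply/minn_idPr/minn_idPr; rewrite me.
pose P : {set F} := [set f : F | `[< exists2 e, N e & label e = f >]]%SET.
apply: (@sdepth_ge K n F P fa snd) => //.
  split=> [f|e Ne|f f' e].
  - by rewrite inE => /asboolP[e Ne <-] e' /(box_stable _ _ Ne)[].
  - by exists (label e); [rewrite inE; apply/asboolP; exists e|exact: in_box].
  - rewrite inE => /asboolP[e1 Ne1 <-]; rewrite inE => /asboolP[e2 Ne2 <-].
    by move=> /(box_stable _ _ Ne1)[_ <-] /(box_stable _ _ Ne2)[_ <-].
move=> f; rewrite inE => /asboolP[e [_ /suppY/LU[_ _ _ kU _]] <-] /=.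
by apply: leq_trans kU _; apply/subset_leq_card/fintype.subsetP => j; rewrite !inE orbC => ->.
Qed.

End SdepthMeets.

(** * Regular sequences of variables *)

Section RegularVariables.
Local Open Scope classical_set_scope.
Local Open Scope ring_scope.
Variables (K : fieldType) (n : nat).
Local Notation S := {mpoly K[n]}.
Implicit Types (E F : set 'X_{1..n}) (e : 'X_{1..n}) (js : seq 'I_n).

Definition vars js : seq S := [seq 'X_j | j <- js].

Definition meets_seq js : set 'X_{1..n} := meets [set j in js]%SET.

Lemma meets_seqP js e : meets_seq js e <-> exists2 j, j \in js & e j != 0%N.
Proof. by split=> -[j jjs ej]; exists j => //; move: jjs; rewrite inE. Qed.

(** An exponent of E with a positive coordinate in js stays in E when this coordinate
    is lowered, because E does not depend on it; this gives the inclusion from right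
    to left. *)
Lemma adjoin_mul_vars E F js : upclosed E -> upclosed F -> indep E [set j in js]%SET ->
  adjoin_mul (monideal K E) (monideal K F) (vars js) =
  monideal K (F `|` (E `&` meets_seq js)).
Proof.
move=> upE upF Ejs.
have upEF : upclosed (F `|` (E `&` meets_seq js)).
  move=> a b [Fa|Ea]; first by left; apply: upF.
  by right; apply: (upclosedI upE (@upclosed_meets _ _)).
apply/seteqP; split.
  apply: adjoin_mul_min => [|f Ff e /Ff|]; [exact: monideal_ideal|by left|].
  move=> _ x /mapP[j jjs ->] Ex e /msuppM_le/allpairsP[[a b] /= [+ /Ex Eb ->]].
  rewrite msuppX inE => /eqP->; right; split; first by rewrite addmC; apply: upE.
  by apply/meets_seqP; exists j => //; rewrite mnmDE mnm1E eqxx.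
apply: monideal_sub_ideal; first exact: adjoin_mul_ideal.
move=> e [Fe|[Ee /meets_seqP[j jjs ej]]].
  by apply: adjoin_mul_base; apply/monidealX.
have je : (U_(j) <= e)%MM by rewrite lep1mP.
rewrite -(submK je) addmC mpolyXD; apply: adjoin_mul_mul; first exact: map_f.
by apply/monidealX/(indep_addU (j := j) Ejs); rewrite ?inE ?submK.
Qed.

(** If x_j x has all its exponents in F or divisible by earlier variables, the same
    holds for x, because multiplication by x_j affects neither condition. *)
Lemma vars_regular E F js i x : upclosed E -> upclosed F -> uniq js ->
  indep E [set j in js]%SET -> indep F [set j in js]%SET -> (i < size js)%N ->
  monideal K E x ->
  adjoin_mul (monideal K E) (monideal K F) (take i (vars js)) ((vars js)`_i * x) ->
  adjoin_mul (monideal K E) (monideal K F) (take i (vars js)) x.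
Proof.
move=> upE upF ujs Ejs Fjs ilt Ex.
have [j0 _] : exists j0, j0 \in js.
  by exists (tnth (in_tuple js) (Ordinal ilt)); apply: mem_tnth.
rewrite (nth_map j0) // /vars -map_take -/(vars _) adjoin_mul_vars //; last first.
  apply: indepS Ejs; apply/fintype.subsetP => j; rewrite !inE; exact: mem_take.
set j := nth j0 js i => Xx e ex.
have jjs : j \in js by apply: mem_nth.
have : (e + U_(j))%MM \in msupp ('X_j * x).
  by rewrite mcoeff_msupp mcoeffXM lem_addl addmK -mcoeff_msupp.
case/Xx => [Fe|[_ /meets_seqP[l ltake el]]].
  by left; apply: (indep_addU (j := j) Fjs); rewrite ?inE.
right; split; first exact: Ex.
apply/meets_seqP; exists l => //; move: el; rewrite mnmDE mnm1E.
suff /negPf-> : j != l by rewrite addn0.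
apply: contraTneq ltake => <-; rewrite -[js](cat_take_drop i) in ujs.
move: ujs; rewrite cat_uniq (drop_nth j0) // => /and3P[_ /hasPn/(_ j)].
by rewrite mem_head => /(_ isT).
Qed.

End RegularVariables.

(** * Adjoining variables *)

Section Extension.
Local Open Scope classical_set_scope.
Local Open Scope ring_scope.
Variables (K : fieldType) (n m : nat).
Local Notation S := {mpoly K[n]}.
Local Notation S' := {mpoly K[n + m]}.
Implicit Types (e a : 'X_{1..n}) (E : set 'X_{1..n}).

Definition restr (b : 'X_{1..n + m}) : 'X_{1..n} := [multinom b (lshift m i) | i < n].

(** The exponents of the extension of an ideal to the larger polynomial ring. *)
Definition ext_set E : set 'X_{1..n + m} := [set b | E (restr b)].

Definition new_vars : m.-tuple 'I_(n + m) := [tuple rshift n j | j < m].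

Definition extend e : 'X_{1..n + m} :=
  [multinom (if split i is inl j then e j else 0%N) | i < n + m].

Lemma mem_new_vars i : (i \in new_vars) = (i \notin [seq lshift m j | j : 'I_n]).
Proof.
case: (split_ordP i) => j ->.
  rewrite map_f ?mem_enum //=; apply/negP => /mapP[k _ /eqP].
  by rewrite eq_lrshift.
rewrite map_f ?mem_enum //; apply/esym/negP => /mapP[k _ /eqP].
by rewrite eq_rlshift.
Qed.

Lemma uniq_new_vars : uniq new_vars.
Proof. by rewrite map_inj_uniq ?enum_uniq //; apply: rshift_inj. Qed.

Lemma card_new_vars : #|[set j in new_vars]%SET| = m.
Proof. by rewrite cardsE (card_uniqP uniq_new_vars) size_tuple. Qed.

Lemma upclosed_ext E : upclosed E -> upclosed (ext_set E).
Proof.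
move=> upE a b; rewrite /ext_set /= => Ea.
have -> : restr (a + b)%MM = (restr a + restr b)%MM by apply/mnmP => i; rewrite !mnmE.
exact: upE.
Qed.

Lemma indep_ext E : indep (ext_set E) [set j in new_vars]%SET.
Proof.
move=> a b ab; rewrite /ext_set /=; suff -> : restr a = restr b by [].
apply/mnmP => i; rewrite !mnmE; apply: ab.
by rewrite inE mem_new_vars negbK map_f ?mem_enum.
Qed.

Lemma extend_lshift e i : extend e (lshift m i) = e i.
Proof. by rewrite mnmE (unsplitK (inl i)). Qed.

Lemma extend_rshift e j : extend e (rshift n j) = 0%N.
Proof. by rewrite mnmE (unsplitK (inr j)). Qed.

Lemma restr_extend e : restr (extend e) = e.
Proof. by apply/mnmP => i; rewrite mnmE extend_lshift. Qed.

Lemma restr0 : restr 0%MM = 0%MM.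
Proof. by apply/mnmP => i; rewrite !mnmE. Qed.

(** Restricting a box to the exponents without new variables gives the empty set if
    its corner involves a new variable, and otherwise a box that has lost at most the
    m new free directions. *)
Lemma sdepth_ext_le E : (sdepth (monideal K (ext_set E)) <= sdepth (monideal K E) + m)%N.
Proof.
have [->//|s0] := posnP (sdepth (monideal K (ext_set E))).
have [t [a [Z [[aE cov disj] Zs]]]] := sdepth_boxes s0.
set s := sdepth _ in s0 Zs *.
pose P := [set i | [forall j, a i (rshift n j) == 0%N]]%SET.
pose a0 i := restr (a i).
pose Z0 i := [set j | lshift m j \in Z i]%SET.
have boxE i e : box (a i) (Z i) (extend e) = (i \in P) && box (a0 i) (Z0 i) e.
  rewrite inE; apply/boxP/andP => [ie|[/forallP iP /boxP ie] j].
    split.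
      apply/forallP => j; have := ie (rshift n j); rewrite extend_rshift leqn0 eq_sym.
      by rewrite [(0 == _)%N]eq_sym if_same.
    by apply/boxP => j; have := ie (lshift m j); rewrite extend_lshift inE mnmE.
  case: (split_ordP j) => l ->.
    by have := ie l; rewrite extend_lshift inE mnmE.
  by rewrite extend_rshift (eqP (iP l)) eqxx if_same.
rewrite addnC -leq_subLR; apply: (@sdepth_ge K n _ P a0 Z0).
- rewrite leq_subLR addnC; exact: sdepth_le_nvars (nat_max_attained s0).
- split=> [i iP e ie|e Ee|i i' e iP i'P ie i'e].
  + have /aE : box (a i) (Z i) (extend e) by rewrite boxE iP.
    by rewrite /ext_set /= restr_extend; apply; rewrite inE.
  + have /cov[i _] : ext_set E (extend e) by rewrite /ext_set /= restr_extend.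
    by rewrite boxE => /andP[iP ie]; exists i.
  + by apply: (disj _ _ (extend e)); rewrite ?inE // boxE ?iP ?i'P.
- move=> i iP; rewrite leq_subLR (leq_trans (Zs i)) //.
  rewrite -[X in (_ <= X + _)%N]card_new_vars -(card_imset _ (@lshift_inj n m)).
  apply: leq_trans (leq_card_setU _ _).
  apply/subset_leq_card/fintype.subsetP => j jZ; rewrite !inE mem_new_vars.
  case: (boolP (j \in [seq _ | _ <- _])) => //= /mapP[l _ jl].
  by apply/imsetP; exists l; rewrite // inE -jl.
Qed.

Definition embed (f : S) : S' := f \mPo [tuple 'X_(lshift m i) | i < n].

Definition project (f : S') : S :=
  f \mPo [tuple (if split i is inl j then 'X_j else 0) | i < n + m].

Lemma embedX e : embed 'X_[e] = 'X_[extend e].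
Proof.
rewrite /embed comp_mpolyX mpolyXE_id big_split_ord /= [X in _ = _ * X]big1 ?mulr1.
  by apply: eq_bigr => i _; rewrite tnth_mktuple extend_lshift.
by move=> j _; rewrite extend_rshift expr0.
Qed.

Lemma projectX b : project 'X_[b] =
  if [forall j, b (rshift n j) == 0%N] then 'X_[restr b] else 0.
Proof.
rewrite /project comp_mpolyX big_split_ord /=.
have -> : \prod_(i < n) tnth [tuple (if split i is inl j then 'X_j else 0) | i < n + m]
    (lshift m i) ^+ b (lshift m i) = 'X_[K, restr b].
  rewrite mpolyXE_id; apply: eq_bigr => i _.
  by rewrite tnth_mktuple (unsplitK (inl i)) mnmE.
case: ifP => [/forallP b0|/negbT].
  rewrite big1 ?mulr1 // => j _; by rewrite (eqP (b0 j)) expr0.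
rewrite negb_forall => /existsP[j bj].
rewrite [X in _ * X](bigD1 j) //= tnth_mktuple (unsplitK (inr j)) expr0n (negPf bj).
by rewrite mul0r mulr0.
Qed.

Lemma project_embedX e : project (embed 'X_[e]) = 'X_[e].
Proof.
rewrite embedX projectX restr_extend; case: ifP => // /negP[].
by apply/forallP => j; rewrite extend_rshift.
Qed.

Lemma embedK f : project (embed f) = f.
Proof.
have : monideal K [set: 'X_{1..n}] f by [].
move: f; apply: monideal_ind => [|f g fK gK|c e _].
- by rewrite /embed /project !comp_mpoly0.
- by rewrite /embed /project !comp_mpolyD -!/(embed _) -!/(project _) fK gK.
- by rewrite /embed /project !comp_mpolyZ -/(embed _) -/(project _) project_embedX.
Qed.

Lemma embed_monideal E f : monideal K E f -> monideal K (ext_set E) (embed f).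
Proof.
move: f; apply: monideal_ind => [|f g Ef Eg|c e Ee]; rewrite /embed.
- by rewrite comp_mpoly0 => e; rewrite msupp0.
- rewrite comp_mpolyD => e /msuppD_le.
  by rewrite mem_cat => /orP[/Ef|/Eg].
- rewrite comp_mpolyZ -/(embed _) embedX => b /msuppZ_le.
  by rewrite msuppX inE => /eqP->; rewrite /ext_set /= restr_extend.
Qed.

Lemma project_monideal E g : monideal K (ext_set E) g -> monideal K E (project g).
Proof.
move: g; apply: monideal_ind => [|f g Ef Eg|c b Eb]; rewrite /project.
- by rewrite comp_mpoly0 => e; rewrite msupp0.
- rewrite comp_mpolyD => e /msuppD_le.
  by rewrite mem_cat => /orP[/Ef|/Eg].
- rewrite comp_mpolyZ -/(project _) projectX => e /msuppZ_le.
  by case: ifP => _; rewrite ?msupp0 // msuppX inE => /eqP->.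
Qed.

(** The difference collects the terms of g that involve a new variable. *)
Lemma sub_embed_project E g : upclosed E -> monideal K (ext_set E) g ->
  monideal K (ext_set E `&` meets_seq new_vars) (g - embed (project g)).
Proof.
move=> upE;
have up' := upclosedI (upclosed_ext upE) (@upclosed_meets _ [set j in new_vars]%SET).
have idE := monideal_ideal K up'.
move: g; apply: monideal_ind => [|f g Ef Eg|c b Eb]; rewrite /embed /project.
- rewrite !comp_mpoly0 subr0; exact: (ideal0 idE).
- by rewrite !comp_mpolyD opprD addrACA; apply: (idealD idE).
- rewrite !comp_mpolyZ -scalerBr -/(project _) -/(embed _) -mul_mpolyC.
  apply: (idealM idE); rewrite projectX; case: ifP => [/forallP b0|/negbT].
    rewrite embedX; have -> : extend (restr b) = b.
      apply/mnmP => i; case: (split_ordP i) => j ->.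
        by rewrite extend_lshift mnmE.
      by rewrite extend_rshift (eqP (b0 j)).
    rewrite subrr; exact: (ideal0 idE).
  rewrite negb_forall => /existsP[j bj].
  rewrite /embed comp_mpoly0 subr0; apply/monidealX; split=> //.
  by exists (rshift n j); rewrite // inE map_f ?mem_enum.
Qed.

Lemma embed_irrelevant u : irrelevant_ideal u -> irrelevant_ideal (embed u).
Proof.
move=> /irrelevant_idealP[g ->]; rewrite /embed raddf_sum.
have idI : is_ideal (@irrelevant_ideal K (n + m)) by exact: ideal_gen_ideal.
apply: (ideal_sum idI) => j _; rewrite /= rmorphM; apply: (idealM idI).
apply: ideal_gen_gen; exists (lshift m j) => //.
by rewrite /= comp_mpolyXU -tnth_nth tnth_mktuple.
Qed.

(** The new variables are regular on the extended ideal I', and modulo them I' is I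
    again; [embed] and [project] transport the submodules generated by the rest of the
    sequence back and forth. *)
Lemma regular_seq_ext E (us : seq S) : upclosed E ->
  regular_seq (monideal K E) [set 0] us ->
  regular_seq (monideal K (ext_set E)) [set 0] (vars K new_vars ++ map embed us).
Proof.
move=> upE [reg neq].
have upE' := upclosed_ext upE.
have idE := monideal_ideal K upE; have idE' := monideal_ideal K upE'.
have set0E : [set 0] = monideal K (n := n + m) (fun=> False).
  apply/seteqP; split=> [_ -> e|f Ef]; first by rewrite msupp0.
  by apply/mpolyP => e; rewrite mcoeff0 (monideal_coef0 Ef).
have upF : upclosed (n := n + m) (fun=> False) by [].
pose B us := adjoin_mul (monideal K E) [set 0] us.
pose B' us := adjoin_mul (monideal K (ext_set E)) [set 0] (vars K new_vars ++ map embed us).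
have projB vs g : B' vs g -> B vs (project g).
  have idB : is_ideal (B vs) by exact: adjoin_mul_ideal.
  have {}idB : is_ideal [set g | B vs (project g)].
    split=> [|f h Bf Bh|f h Bh]; rewrite /= /project.
    - rewrite comp_mpoly0; exact: (ideal0 idB).
    - rewrite comp_mpolyD; exact: (idealD idB).
    - rewrite rmorphM; exact: (idealM idB).
  move: g; apply: adjoin_mul_min => // [_ ->|u x]; first exact: (ideal0 idB).
  rewrite mem_cat => /orP[/mapP[_ /mapP[j _ ->] ->] _|/mapP[v vvs ->] Ex].
    rewrite /project rmorphM /= comp_mpolyXU -tnth_nth tnth_mktuple (unsplitK (inr j)).
    rewrite mul0r; exact: (ideal0 (adjoin_mul_ideal _ _ _)).
  rewrite /= /project rmorphM -/(project _) -/(project _) /= -!/(project _) embedK.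
  by apply: adjoin_mul_mul => //; apply: project_monideal.
have embB vs f : B vs f -> B' vs (embed f).
  have idB' : is_ideal (B' vs) by exact: adjoin_mul_ideal.
  have {}idB : is_ideal [set f | B' vs (embed f)].
    split=> [|g h Bg Bh|g h Bh]; rewrite /= /embed.
    - rewrite comp_mpoly0; exact: (ideal0 idB').
    - rewrite comp_mpolyD; exact: (idealD idB').
    - rewrite rmorphM; exact: (idealM idB').
  move: f; apply: adjoin_mul_min => // [_ ->|u x uvs Ex]; first exact: (ideal0 idB).
  rewrite /= /embed rmorphM -!/(embed _) /=.
  apply: adjoin_mul_mul; last exact: embed_monideal.
  by rewrite mem_cat map_f ?orbT.
have size_vars : size (vars K new_vars) = m by rewrite size_map size_tuple.
split=> [i|eqE].
  rewrite size_cat size_vars size_map => ilt x Ex.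
  rewrite take_cat nth_cat size_vars; case: ltnP => im.
    rewrite set0E; apply: vars_regular => //.
    - exact: uniq_new_vars.
    - exact: indep_ext.
    - by rewrite size_tuple.
  have ius : (i - m < size us)%N by rewrite ltn_subLR.
  rewrite (nth_map 0) // -map_take => /projB.
  rewrite /project rmorphM /= -!/(project _) embedK
    => /(reg _ ius _ (project_monideal Ex))/embB Bx.
  have idB' : is_ideal (B' (take (i - m) us)) by exact: adjoin_mul_ideal.
  rewrite -[x](subrK (embed (project x))); apply: (idealD idB') => //.
  have := sub_embed_project upE Ex.
  have <- : (fun=> False) `|` (ext_set E `&` meets_seq new_vars) =
            ext_set E `&` meets_seq new_vars by exact: set0U.
  rewrite -adjoin_mul_vars //; last exact: indep_ext.
  rewrite -set0E; apply: adjoin_mul_min => // [_ ->|u y uy Ey]; first exact: (ideal0 idB').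
  by apply: adjoin_mul_mul => //; rewrite mem_cat uy.
apply: neq; apply/seteqP; split.
  apply: adjoin_mul_min => // [_ ->|u x _ Ex]; first exact: (ideal0 idE).
  exact: (idealM idE).
move=> f /embed_monideal; rewrite -eqE => /projB; by rewrite embedK.
Qed.

(** The positivity hypothesis guarantees that the depth of the smaller ideal is
    attained by a regular sequence, which is then extended by the new variables. *)
Lemma depth_ext_ge E : upclosed E -> (exists e, E e) ->
  (0 < depth (monideal K E))%N ->
  (depth (monideal K E) + m <= depth (monideal K (ext_set E)))%N.
Proof.
move=> upE [e Ee] /nat_max_attained; rewrite -/(depth _) => -[us [us_irr reg]].
have upE' := upclosed_ext upE.
apply: (le_nat_max (b := (n + m)%N)) => [d [vs [vs_irr vs_reg]]|].
  rewrite -(size_tuple vs); apply: regular_seq_size_le_nvars vs_reg vs_irr => //.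
  by exists (extend e); rewrite /ext_set /= restr_extend.
rewrite [(depth _ + m)%N]addnC; exists [tuple of vars K new_vars ++ map embed us]; split.
  move=> u; rewrite mem_cat => /orP[/mapP[j _ ->]|/mapP[v /us_irr v_irr ->]].
    by apply: ideal_gen_gen; exists j.
  exact: embed_irrelevant.
exact: regular_seq_ext.
Qed.

End Extension.

(** * The equivalence *)

Section Equivalence.
Local Open Scope classical_set_scope.
Local Open Scope ring_scope.
Variable K : fieldType.

Lemma ideal_gen_vars n (js : seq 'I_n) :
  ideal_gen [set` vars K js] = monideal K (meets_seq js).
Proof.
apply: ideal_gen_monideal; first exact: upclosed_meets.
- move=> _ /= /mapP[j jjs ->]; apply/monidealX/meets_seqP; exists j => //.
  by rewrite mnm1E eqxx.
- move=> e /meets_seqP[j jjs ej].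
  have je : (U_(j) <= e)%MM by rewrite lep1mP.
  rewrite -(submK je) mpolyXD; apply: (idealM (ideal_gen_ideal _)).
  by apply: ideal_gen_gen; apply: (map_f _ jjs).
Qed.

Lemma regular_ideal_nonzero_proper n m (I : set {mpoly K[n]}) (us : m.-tuple {mpoly K[n]}) :
  (1 <= m)%N -> (forall u, u \in us -> is_monomial u) ->
  regular_seq [set: {mpoly K[n]}] I us -> nonzero_proper (ideal_gen [set` us]).
Proof.
move=> m1 us_mon [_ neqT]; split=> [J0|JT].
  have u_us := mem_tnth (Ordinal m1) us; have [e ue] := us_mon _ u_us.
  have : ideal_gen [set` us] (tnth us (Ordinal m1)) by apply: ideal_gen_gen.
  rewrite J0 ue => /(congr1 (mcoeff e)); rewrite mcoeffX eqxx mcoeff0.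
  by apply/eqP; rewrite oner_eq0.
apply: neqT; apply/seteqP; split=> // x _.
have : ideal_gen [set` us] x by rewrite JT.
apply: ideal_gen_min x; first exact: adjoin_mul_ideal.
by move=> u uus; rewrite -[u]mulr1; apply: adjoin_mul_mul.
Qed.

Lemma ext_set_nonzero_proper n m (E : set 'X_{1..n}) :
  (exists e, E e) -> ~ E 0%MM -> nonzero_proper (monideal K (@ext_set n m E)).
Proof.
move=> [e Ee] E0; split=> [|ET].
  have : monideal K (@ext_set n m E) 'X_[extend m e].
    by apply/monidealX; rewrite /ext_set /= restr_extend.
  move=> + M0; rewrite M0 => /(congr1 (mcoeff (extend m e))).
  by rewrite mcoeffX eqxx mcoeff0; apply/eqP; rewrite oner_eq0.
have /monidealX : monideal K (@ext_set n m E) 'X_[0%MM] by rewrite ET.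
by rewrite /ext_set /= restr0.
Qed.

(** S'/I' is a polynomial ring over S/I in the new variables; both S' and I' are
    independent of them, so the regularity of variables applies. *)
Lemma new_vars_regular n m (E : set 'X_{1..n}) : upclosed E -> ~ E 0%MM ->
  regular_seq [set: {mpoly K[n + m]}] (monideal K (ext_set E)) (vars K (new_vars n m)).
Proof.
move=> upE E0; have upE' := upclosed_ext (m := m) upE.
have upT : upclosed [set: 'X_{1..n + m}] by [].
have TE : [set: {mpoly K[n + m]}] = monideal K [set: 'X_{1..n + m}].
  by apply/seteqP; split.
rewrite TE; split=> [i|].
  rewrite size_map => ilt x _; apply: vars_regular => //.
  - exact: uniq_new_vars.
  - exact: indep_ext.
rewrite adjoin_mul_vars // -TE => eqT.
have : monideal K (ext_set E `|` ([set: 'X_{1..n + m}] `&` meets_seq (new_vars n m))) 1.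
  by rewrite eqT.
rewrite -mpolyX0 => /monidealX[|[_ [j _]]]; last by rewrite mnm0E.
by rewrite /ext_set /= restr0.
Qed.

(** Both sides are compared with n + 1: the depth does not exceed this bound, however
    many new variables there are, and 3 ^ n of them suffice for the Stanley depth to
    reach it. *)
Lemma depth_meets_le_sdepth n (E : set 'X_{1..n}) : upclosed E -> (exists e, E e) ->
  (depth (monideal K (ext_set E `&` meets_seq (new_vars n (3 ^ n)))) <=
   sdepth (monideal K (ext_set E `&` meets_seq (new_vars n (3 ^ n)))))%N.
Proof.
set m := (3 ^ n)%N => upE [e Ee].
have m0 : (0 < m)%N by rewrite expn_gt0.
have cY : #|[set j in new_vars n m]%SET| = m by exact: card_new_vars.
have upE' := upclosed_ext (m := m) upE.
apply: (@leq_trans n.+1); last first.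
  apply: sdepth_meets_ge => //; first exact: indep_ext.
    exact: top_heavy_exp3.
  by rewrite -addn1 leq_add2l.
apply: nat_max_le => d [us [us_irr reg]]; rewrite -(size_tuple us).
have cX : #|(~: [set j in new_vars n m])%SET| = n.
  have := cardsC [set j in new_vars n m]%SET; rewrite cY card_ord => cX.
  by apply: (@addnI m); rewrite cX; apply: addnC.
rewrite -[X in (_ <= X.+1)%N]cX.
apply: (regular_seq_meets_size_le upE' _ _ _ reg us_irr); last exact: indep_ext.
  by exists (extend m e); rewrite /ext_set /= restr_extend.
exists (rshift n (Ordinal m0)); rewrite inE map_f ?mem_enum //.
Qed.

End Equivalence.

Local Open Scope classical_set_scope.

Theorem proposition3p3 (K : fieldType) :
  [<-> (forall (n : nat) (I : set {mpoly K[n]}), (1 <= n)%N ->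
          is_monomial_ideal I -> nonzero_proper I ->
          (depth I <= sdepth I)%N);
       (forall (n : nat) (I J : set {mpoly K[n]}), (1 <= n)%N ->
          is_monomial_ideal I -> nonzero_proper I ->
          is_monomial_ideal J -> nonzero_proper J ->
          (depth (I `&` J) <= sdepth (I `&` J))%N ->
          (depth I <= sdepth I)%N);
       (forall (n m : nat) (I : set {mpoly K[n]}) (us : m.-tuple {mpoly K[n]}),
          (1 <= n)%N -> (1 <= m)%N ->
          is_monomial_ideal I -> nonzero_proper I ->
          (forall u, u \in us -> is_monomial u) ->
          regular_seq [set: {mpoly K[n]}] I us ->
          let J := ideal_gen [set` us] in
          (depth (I `&` J) <= sdepth (I `&` J))%N ->
          (depth I <= sdepth I)%N)].
Proof.
tfae=> [h1 n I J n1 monI npI _ _ _|h2 n m I us n1 m1 monI npI us_mon reg J|h3 n I n1].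
- exact: h1.
- apply: (h2 n I J) => //; last exact: regular_ideal_nonzero_proper reg.
  by exists [set` us].
- move=> /monomial_idealP[E upE ->] [/monideal_neq0 exE /(monideal_neqT upE) E0].
  have [->//|depth0] := posnP (depth (monideal K E)).
  have := h3 (n + 3 ^ n)%N (3 ^ n)%N (monideal K (ext_set E))
    [tuple of vars K (new_vars n (3 ^ n))].
  rewrite /= ideal_gen_vars monidealI => /(_ _ _ _ _ _ _ (depth_meets_le_sdepth K upE exE)).
  move=> h; rewrite -(leq_add2r (3 ^ n)).
  apply: leq_trans (depth_ext_ge (3 ^ n) upE exE depth0) _.
  apply: leq_trans _ (sdepth_ext_le K (3 ^ n) E); apply: h.
  + by rewrite (leq_trans n1) // leq_addr.
  + by rewrite expn_gt0.
  + by apply/monomial_idealP; exists (ext_set E) => //; apply: upclosed_ext.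
  + exact: ext_set_nonzero_proper.
  + by move=> _ /mapP[j _ ->]; exists U_(j)%MM.
  + exact: new_vars_regular.
Qed.
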